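(* The model structure on $\mathbf{DblCat}$ induced by the 2-monad $\overline{M}$ on $\mathsf{Cat}(\mathbf{Graph})$ is the $\tau'$-model structure, i.e. it coincides with the model structure on $\mathbf{DblCat}$ induced by the categorically surjective topology $\tau'$ on $\mathbf{Cat}$.
   Context: Double categories: $\mathbf{DblCat}$ is the category of internal categories in $\mathbf{Cat}$ (small double categories) and internal functors (double functors). A double category $\mathbb{B}$ has a category $\mathbb{B}_0$ of objects and vertical morphisms and a category $\mathbb{B}_1$ of horizontal morphisms and squares (composed vertically), with horizontal source and target functors $s,t:\mathbb{B}_1\to\mathbb{B}_0$. 2-monad: let $\mathbf{Graph}$ be the category of small directed (non-reflexive) graphs, and $M$ the (Cartesian) free category monad on $\mathbf{Graph}$, whose algebras are small categories. $M$ induces a 2-monad $\overline{M}$ on the 2-category $\mathsf{Cat}(\mathbf{Graph})$ of internal categories, internal functors and internal natural transformations in $\mathbf{Graph}$. Strict $\overline{M}$-algebras, strict morphisms and 2-cells are double categories, double functors and horizontal natural transformations (i.e. internal natural transformations in $\mathbf{Cat}$). The model structure on $\mathbf{DblCat}$ induced by $\overline{M}$ (Lack) is the one in which a double functor $G$ is a weak equivalence (respectively fibration) if and only if the underlying morphism $\overline{U}G$ of $\mathsf{Cat}(\mathbf{Graph})$ is a weak equivalence (respectively fibration) in the trivial model structure on $\mathsf{Cat}(\mathbf{Graph})$, that is, an equivalence (respectively isofibration) in the 2-category $\mathcal{K}=\mathsf{Cat}(\mathbf{Graph})$. A morphism $f:A\to B$ of a 2-category is an isofibration if for all $a:E\to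 A$, $b:E\to B$ and invertible 2-cells $\beta:b\cong fa$ there are $a':E\to A$ and an invertible 2-cell $\alpha:a'\cong a$ with $fa'=b$ and $f\alpha=\beta$. $\tau'$-model structure: a functor is categorically surjective if it is surjective on objects and full; the singletons $\{F\}$ with $F$ categorically surjective form a basis for a Grothendieck topology $\tau'$ on $\mathbf{Cat}$. A functor $p:\mathbf{E}\to\mathbf{B}$ is $\tau'$-epi if its image under the Yoneda embedding followed by $\tau'$-sheafification is an epimorphism; equivalently, for every functor $g:\mathbf{X}\to\mathbf{B}$ there are a categorically surjective $f:\mathbf{U}\to\mathbf{X}$ and a functor $u:\mathbf{U}\to\mathbf{E}$ with $pu=gf$. Let $\mathsf{iso}(\mathbb{B})_1\subseteq\mathbb{B}_1$ be the subcategory of invertible horizontal morphisms and horizontally invertible squares. For a double functor $F:\mathbb{A}\to\mathbb{B}$ let $(\mathbb{P}_F)_0=\mathbb{A}_0\times_{\mathbb{B}_0}\mathsf{iso}(\mathbb{B})_1$ be the pullback of $F_0$ and $t$, with projection $\overline F_0:(\mathbb{P}_F)_0\to\mathsf{iso}(\mathbb{B})_1$. The $\tau'$-model structure (which exists) has as weak equivalences the $F$ such that $s\circ\overline F_0:(\mathbb{P}_F)_0\to\mathbb{B}_0$ is $\tau'$-epi and $F$ is fully faithful (the square formed by $F_1$, $F_0\times F_0$ and the functors $(s,t)$ is a pullback in $\mathbf{Cat}$); its fibrations are the $F$ for which the induced functor $(r_F)_0:\mathsf{iso}(\mathbb{A})_1\to(\mathbb{P}_F)_0$ (with components $t$ and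 $\mathsf{iso}(F)_1$) is $\tau'$-epi; its cofibrations are the double functors with the left lifting property against acyclic fibrations. *)

(* Defs.v *)
From Stdlib Require Import Setoid ProofIrrelevance FunctionalExtensionality.

Set Implicit Arguments.
Set Primitive Projections.

Record Category := {
  obj :> Type;
  hom : obj -> obj -> Type;
  idc : forall x, hom x x;
  compc : forall x y z, hom y z -> hom x y -> hom x z;
  compc_idl : forall x y (f : hom x y), compc (idc y) f = f;
  compc_idr : forall x y (f : hom x y), compc f (idc x) = f;
  compc_assoc : forall w x y z (h : hom y z) (g : hom x y) (f : hom w x),
      compc h (compc g f) = compc (compc h g) f }.

Arguments hom {c} x y.
Arguments idc {c} x.
Arguments compc {c x y z} g f.

Declare Scope cat_scope.
Open Scope cat_scope.
Notation "g ∘ f" := (compc g f) (at level 40, left associativity) : cat_scope.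

(** The square [f ∘ p = g ∘ q] is a pullback. *)
Definition is_pullback {E : Category} {P A B C : E}
    (f : hom A C) (g : hom B C) (p : hom P A) (q : hom P B) : Prop :=
  f ∘ p = g ∘ q /\
  forall (X : E) (u : hom X A) (v : hom X B), f ∘ u = g ∘ v ->
    exists! w : hom X P, p ∘ w = u /\ q ∘ w = v.

Record PbCategory := {
  pb_cat :> Category;
  pb : forall {A B C : pb_cat}, hom A C -> hom B C -> pb_cat;
  pb1 : forall {A B C : pb_cat} (f : hom A C) (g : hom B C), hom (pb f g) A;
  pb2 : forall {A B C : pb_cat} (f : hom A C) (g : hom B C), hom (pb f g) B;
  pb_comm : forall (A B C : pb_cat) (f : hom A C) (g : hom B C),
      f ∘ pb1 f g = g ∘ pb2 f g;
  pb_pair : forall {A B C : pb_cat} {f : hom A C} {g : hom B C} {X : pb_cat} (u : hom X A) (v : hom X B),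
      f ∘ u = g ∘ v -> hom X (pb f g);
  pb1_pair : forall (A B C : pb_cat) (f : hom A C) (g : hom B C) (X : pb_cat) (u : hom X A) (v : hom X B)
      (e : f ∘ u = g ∘ v), pb1 f g ∘ pb_pair (f := f) (g := g) u v e = u;
  pb2_pair : forall (A B C : pb_cat) (f : hom A C) (g : hom B C) (X : pb_cat) (u : hom X A) (v : hom X B)
      (e : f ∘ u = g ∘ v), pb2 f g ∘ pb_pair (f := f) (g := g) u v e = v;
  pb_ext : forall (A B C : pb_cat) (f : hom A C) (g : hom B C) (X : pb_cat) (w w' : hom X (pb f g)),
      pb1 f g ∘ w = pb1 f g ∘ w' -> pb2 f g ∘ w = pb2 f g ∘ w' -> w = w' }.

Arguments pb {p A B C} f g.
Arguments pb1 {p A B C} f g.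
Arguments pb2 {p A B C} f g.
Arguments pb_comm {p A B C} f g.
Arguments pb_pair {p A B C f g X} u v e.
Arguments pb_ext {p A B C f g X} w w' _ _.

(** [pb ics ict] is the object of composable pairs [(g, f)], with [s g = t f],
    and [icm] sends such a pair to [g ∘ f].  The commutation proofs required by
    [pb_pair] always exist; the axioms hold for any of them. *)
Record IntCat (E : PbCategory) := {
  ic0 : E;
  ic1 : E;
  ics : hom ic1 ic0;
  ict : hom ic1 ic0;
  ici : hom ic0 ic1;
  icm : hom (pb ics ict) ic1;
  ics_i : ics ∘ ici = idc ic0;
  ict_i : ict ∘ ici = idc ic0;
  ics_m : ics ∘ icm = ics ∘ pb2 ics ict;
  ict_m : ict ∘ icm = ict ∘ pb1 ics ict;
  icm_idr : forall e, icm ∘ pb_pair (idc ic1) (ici ∘ ics) e = idc ic1;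
  icm_idl : forall e, icm ∘ pb_pair (ici ∘ ict) (idc ic1) e = idc ic1;
  icm_assoc :
    (* the object of composable triples [((h, g), f)] *)
    let p := pb1 (ics ∘ pb2 ics ict) ict in
    let q := pb2 (ics ∘ pb2 ics ict) ict in
    forall e1 e2 e3,
      icm ∘ pb_pair (icm ∘ p) q e1 =
      icm ∘ pb_pair (pb1 ics ict ∘ p)
                 (icm ∘ pb_pair (pb2 ics ict ∘ p) q e2) e3 }.

Record IntFunctor (E : PbCategory) (A B : IntCat E) := {
  if0 : hom (ic0 A) (ic0 B);
  if1 : hom (ic1 A) (ic1 B);
  if_s : ics B ∘ if1 = if0 ∘ ics A;
  if_t : ict B ∘ if1 = if0 ∘ ict A;
  if_i : if1 ∘ ici A = ici B ∘ if0;
  if_m : forall e,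
      if1 ∘ icm A =
      icm B ∘ pb_pair (if1 ∘ pb1 (ics A) (ict A)) (if1 ∘ pb2 (ics A) (ict A)) e }.

Lemma int_functor_eq (E : PbCategory) (A B : IntCat E) (F G : IntFunctor A B) :
  if0 F = if0 G -> if1 F = if1 G -> F = G.
Proof.
destruct F, G; simpl; intros -> ->; f_equal; apply proof_irrelevance.
Qed.

Definition int_id (E : PbCategory) (A : IntCat E) : IntFunctor A A.
Proof.
refine {| if0 := idc (ic0 A); if1 := idc (ic1 A) |}.
- abstract (now rewrite compc_idl, compc_idr).
- abstract (now rewrite compc_idl, compc_idr).
- abstract (now rewrite compc_idl, compc_idr).
- abstract (intros e; rewrite compc_idl;
    rewrite <- (compc_idr _ _ _ (icm A)) at 1;
    f_equal; apply pb_ext;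
    [ now rewrite pb1_pair, compc_idr, compc_idl
    | now rewrite pb2_pair, compc_idr, compc_idl ]).
Defined.

Lemma int_comp_m (E : PbCategory) (A B C : IntCat E)
    (G : IntFunctor B C) (F : IntFunctor A B) e :
  (if1 G ∘ if1 F) ∘ icm A =
  icm C ∘ pb_pair ((if1 G ∘ if1 F) ∘ pb1 (ics A) (ict A))
               ((if1 G ∘ if1 F) ∘ pb2 (ics A) (ict A)) e.
Proof.
assert (eF : ics B ∘ (if1 F ∘ pb1 (ics A) (ict A)) =
             ict B ∘ (if1 F ∘ pb2 (ics A) (ict A))).
{ rewrite !compc_assoc, if_s, if_t, <- !compc_assoc.
  f_equal; apply pb_comm. }
assert (eG : ics C ∘ (if1 G ∘ pb1 (ics B) (ict B)) =
             ict C ∘ (if1 G ∘ pb2 (ics B) (ict B))).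
{ rewrite !compc_assoc, if_s, if_t, <- !compc_assoc.
  f_equal; apply pb_comm. }
rewrite <- compc_assoc, (if_m F eF), compc_assoc, (if_m G eG), <- compc_assoc.
f_equal; apply pb_ext.
- rewrite pb1_pair, compc_assoc, pb1_pair.
  rewrite <- (compc_assoc _ _ _ _ _ (if1 G)), pb1_pair.
  apply compc_assoc.
- rewrite pb2_pair, compc_assoc, pb2_pair.
  rewrite <- (compc_assoc _ _ _ _ _ (if1 G)), pb2_pair.
  apply compc_assoc.
Qed.

Definition int_comp (E : PbCategory) (A B C : IntCat E)
    (G : IntFunctor B C) (F : IntFunctor A B) : IntFunctor A C.
Proof.
refine {| if0 := if0 G ∘ if0 F; if1 := if1 G ∘ if1 F; if_m := int_comp_m G F |}.
- abstract (now rewrite compc_assoc, if_s, <- compc_assoc, if_s, compc_assoc).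
- abstract (now rewrite compc_assoc, if_t, <- compc_assoc, if_t, compc_assoc).
- abstract (now rewrite <- compc_assoc, if_i, compc_assoc, if_i, compc_assoc).
Defined.

(** The category of internal categories and internal functors in [E]. *)
Definition CatIn (E : PbCategory) : Category.
Proof.
refine {| obj := IntCat E; hom := @IntFunctor E;
          idc := @int_id E; compc := @int_comp E |};
  abstract (intros; apply int_functor_eq; simpl;
            solve [apply compc_idl | apply compc_idr | apply compc_assoc]).
Defined.

(** The 2-cells of [CatIn E] are the internal natural transformations. *)
Record IntNat (E : PbCategory) (A B : IntCat E) (F G : IntFunctor A B) := {
  nt :> hom (ic0 A) (ic1 B);
  nt_s : ics B ∘ nt = if0 F;
  nt_t : ict B ∘ nt = if0 G;
  nt_nat : forall e e',
      icm B ∘ pb_pair (if1 G) (nt ∘ ics A) e = icm B ∘ pb_pair (nt ∘ ict A) (if1 F) e' }.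

(** Two 2-cells are equal when their underlying morphisms [nt] are; the
    vertical composite of [b] and [a] has underlying morphism
    [icm ∘ pb_pair b a], and the identity 2-cell of [F] has [ici ∘ if0 F]. *)
Definition invertible_2cell (E : PbCategory) (A B : IntCat E)
    (F G : IntFunctor A B) (a : IntNat F G) : Prop :=
  exists b : IntNat G F,
    (forall e, icm B ∘ pb_pair (nt b) (nt a) e = ici B ∘ if0 F) /\
    (forall e, icm B ∘ pb_pair (nt a) (nt b) e = ici B ∘ if0 G).

(** Equivalences in the 2-category [CatIn E]. *)
Definition is_equivalence (E : PbCategory) (A B : IntCat E)
    (F : IntFunctor A B) : Prop :=
  exists (G : IntFunctor B A)
         (a : IntNat (int_comp G F) (int_id A))
         (b : IntNat (int_id B) (int_comp F G)),
    invertible_2cell a /\ invertible_2cell b.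

(** Isofibrations in the 2-category [CatIn E].  The whiskering of [F] with
    [alpha] has underlying morphism [if1 F ∘ nt alpha]. *)
Definition is_isofibration (E : PbCategory) (A B : IntCat E)
    (F : IntFunctor A B) : Prop :=
  forall (X : IntCat E) (a : IntFunctor X A) (b : IntFunctor X B)
         (beta : IntNat b (int_comp F a)), invertible_2cell beta ->
  exists (a' : IntFunctor X A) (alpha : IntNat a' a),
    invertible_2cell alpha /\ int_comp F a' = b /\ if1 F ∘ nt alpha = nt beta.

Lemma ic_assoc_eq1 (E : PbCategory) (A : IntCat E)
    (p := pb1 (ics A ∘ pb2 (ics A) (ict A)) (ict A))
    (q := pb2 (ics A ∘ pb2 (ics A) (ict A)) (ict A)) :
  ics A ∘ (icm A ∘ p) = ict A ∘ q.
Proof. unfold p; rewrite compc_assoc, ics_m; apply pb_comm. Qed.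

Lemma ic_assoc_eq2 (E : PbCategory) (A : IntCat E)
    (p := pb1 (ics A ∘ pb2 (ics A) (ict A)) (ict A))
    (q := pb2 (ics A ∘ pb2 (ics A) (ict A)) (ict A)) :
  ics A ∘ (pb2 (ics A) (ict A) ∘ p) = ict A ∘ q.
Proof. unfold p; rewrite compc_assoc; apply pb_comm. Qed.

Lemma ic_assoc_eq3 (E : PbCategory) (A : IntCat E)
    (p := pb1 (ics A ∘ pb2 (ics A) (ict A)) (ict A))
    (q := pb2 (ics A ∘ pb2 (ics A) (ict A)) (ict A)) e :
  ics A ∘ (pb1 (ics A) (ict A) ∘ p) =
  ict A ∘ (icm A ∘ pb_pair (pb2 (ics A) (ict A) ∘ p) q e).
Proof.
rewrite (compc_assoc _ _ _ _ _ (ict A)), ict_m, <- (compc_assoc _ _ _ _ _ (ict A)).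
rewrite pb1_pair, !compc_assoc; f_equal; apply pb_comm.
Qed.

(** A model structure is given by its three classes of morphisms, and two
    model structures coincide exactly when these classes do. *)
Record ModelStructure (C : Category) := {
  weq : forall x y : C, hom x y -> Prop;
  fib : forall x y : C, hom x y -> Prop;
  cof : forall x y : C, hom x y -> Prop }.

Definition has_lift {C : Category} {A B X Y : C}
    (j : hom A B) (p : hom X Y) : Prop :=
  forall (u : hom A X) (v : hom B Y), p ∘ u = v ∘ j ->
    exists h : hom B X, h ∘ j = u /\ p ∘ h = v.

(** In a model structure the cofibrations are determined by the weak
    equivalences [W] and the fibrations [R]. *)
Definition model_structure_of (C : Category)
    (W R : forall x y : C, hom x y -> Prop) : ModelStructure C := {|
  weq := W;
  fib := R;
  cof := fun A B j =>
    forall (X Y : C) (p : hom X Y), W X Y p -> R X Y p -> has_lift j p |}.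

Definition Small := Type.

Record Graph : Type := {
  vert : Small;
  edge : Small;
  src : edge -> vert;
  tgt : edge -> vert }.

Arguments src {g} e.
Arguments tgt {g} e.

Record GraphMor (G H : Graph) := {
  on_vert : vert G -> vert H;
  on_edge : edge G -> edge H;
  on_src : forall e, src (on_edge e) = on_vert (src e);
  on_tgt : forall e, tgt (on_edge e) = on_vert (tgt e) }.

Lemma graph_mor_ext (G H : Graph) (f g : GraphMor G H) :
  (forall x, on_vert f x = on_vert g x) ->
  (forall x, on_edge f x = on_edge g x) -> f = g.
Proof.
destruct f as [fv fe ? ?], g as [gv ge ? ?]; simpl; intros ev ee.
apply functional_extensionality in ev, ee; subst gv ge.
f_equal; apply proof_irrelevance.
Qed.

Definition graph_id (G : Graph) : GraphMor G G := {|
  on_vert := fun x => x;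
  on_edge := fun x => x;
  on_src := fun e => eq_refl;
  on_tgt := fun e => eq_refl |}.

Definition graph_comp (G H K : Graph) (g : GraphMor H K) (f : GraphMor G H) :
  GraphMor G K.
Proof.
refine {| on_vert := fun x => on_vert g (on_vert f x);
          on_edge := fun x => on_edge g (on_edge f x) |}.
- abstract (intros e; now rewrite !on_src).
- abstract (intros e; now rewrite !on_tgt).
Defined.

Definition Graph_cat : Category.
Proof.
refine {| obj := Graph; hom := GraphMor;
          idc := graph_id; compc := graph_comp |};
  abstract (intros; now apply graph_mor_ext).
Defined.

Definition graph_pb (A B C : Graph) (f : GraphMor A C) (g : GraphMor B C) : Graph.
Proof.
refine {| vert := {x : vert A * vert B | on_vert f (fst x) = on_vert g (snd x)};
          edge := {x : edge A * edge B | on_edge f (fst x) = on_edge g (snd x)};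
          src := fun x => exist _ (src (fst (proj1_sig x)), src (snd (proj1_sig x))) _;
          tgt := fun x => exist _ (tgt (fst (proj1_sig x)), tgt (snd (proj1_sig x))) _ |}.
- abstract (destruct x as [[a b] e]; simpl in *; now rewrite <- !on_src, e).
- abstract (destruct x as [[a b] e]; simpl in *; now rewrite <- !on_tgt, e).
Defined.

Definition graph_pb1 (A B C : Graph) (f : GraphMor A C) (g : GraphMor B C) :
  GraphMor (graph_pb f g) A :=
  Build_GraphMor (graph_pb f g) A
    (fun x => fst (proj1_sig x)) (fun x => fst (proj1_sig x))
    (fun x => eq_refl) (fun x => eq_refl).

Definition graph_pb2 (A B C : Graph) (f : GraphMor A C) (g : GraphMor B C) :
  GraphMor (graph_pb f g) B :=
  Build_GraphMor (graph_pb f g) B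
    (fun x => snd (proj1_sig x)) (fun x => snd (proj1_sig x))
    (fun x => eq_refl) (fun x => eq_refl).

Lemma sig_ext (T : Type) (P : T -> Prop) (x y : sig P) :
  proj1_sig x = proj1_sig y -> x = y.
Proof.
destruct x, y; simpl; intros ->; f_equal; apply proof_irrelevance.
Qed.

Definition graph_pair (A B C : Graph) (f : GraphMor A C) (g : GraphMor B C)
    (X : Graph) (u : GraphMor X A) (v : GraphMor X B)
    (e : graph_comp f u = graph_comp g v) : GraphMor X (graph_pb f g).
Proof.
refine (Build_GraphMor X (graph_pb f g)
  (fun x => exist _ (on_vert u x, on_vert v x) (f_equal (fun k => on_vert k x) e))
  (fun x => exist _ (on_edge u x, on_edge v x) (f_equal (fun k => on_edge k x) e))
  _ _).
- abstract (intros x; apply sig_ext; simpl; now rewrite !on_src).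
- abstract (intros x; apply sig_ext; simpl; now rewrite !on_tgt).
Defined.

Arguments graph_pair {A B C f g X} u v e.

Lemma graph_pb_ext (A B C : Graph) (f : GraphMor A C) (g : GraphMor B C)
    (X : Graph) (w w' : GraphMor X (graph_pb f g)) :
  graph_comp (graph_pb1 f g) w = graph_comp (graph_pb1 f g) w' ->
  graph_comp (graph_pb2 f g) w = graph_comp (graph_pb2 f g) w' -> w = w'.
Proof.
intros e1 e2; apply graph_mor_ext; intros x; apply sig_ext.
- pose proof (f_equal (fun k => on_vert k x) e1) as h1.
  pose proof (f_equal (fun k => on_vert k x) e2) as h2.
  simpl in h1, h2; rewrite (surjective_pairing (proj1_sig (on_vert w x))), h1, h2.
  now destruct (proj1_sig (on_vert w' x)).
- pose proof (f_equal (fun k => on_edge k x) e1) as h1.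
  pose proof (f_equal (fun k => on_edge k x) e2) as h2.
  simpl in h1, h2; rewrite (surjective_pairing (proj1_sig (on_edge w x))), h1, h2.
  now destruct (proj1_sig (on_edge w' x)).
Qed.

Definition GRAPH : PbCategory.
Proof.
refine {| pb_cat := Graph_cat; pb := graph_pb;
          pb1 := graph_pb1; pb2 := graph_pb2; pb_pair := @graph_pair |}.
- abstract (intros A B C f g; apply graph_mor_ext; intros [[a b] e]; exact e).
- abstract (intros; now apply graph_mor_ext).
- abstract (intros; now apply graph_mor_ext).
- exact graph_pb_ext.
Defined.

(** [cmp g f e] is the composite of [g] after [f]. *)
Record SmallCat : Type := {
  gr :> Graph;
  idm : vert gr -> edge gr;
  cmp : forall g f : edge gr, src g = tgt f -> edge gr;
  src_idm : forall x, src (idm x) = x;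
  tgt_idm : forall x, tgt (idm x) = x;
  src_cmp : forall g f e, src (cmp g f e) = src f;
  tgt_cmp : forall g f e, tgt (cmp g f e) = tgt g;
  cmp_idl : forall f e, cmp (idm (tgt f)) f e = f;
  cmp_idr : forall f e, cmp f (idm (src f)) e = f;
  cmp_assoc : forall h g f e1 e2 e3 e4,
      cmp h (cmp g f e1) e2 = cmp (cmp h g e3) f e4 }.

Arguments idm {s} x.
Arguments cmp {s} g f e.

Record Functor (C D : SmallCat) := {
  fgr :> GraphMor C D;
  f_idm : forall x, on_edge fgr (idm x) = idm (on_vert fgr x);
  f_cmp : forall g f e e',
      on_edge fgr (cmp g f e) = cmp (on_edge fgr g) (on_edge fgr f) e' }.

Lemma functor_eq (C D : SmallCat) (F G : Functor C D) : fgr F = fgr G -> F = G.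
Proof.
destruct F, G; simpl; intros ->; f_equal; apply proof_irrelevance.
Qed.

Lemma cmp_congr (C : SmallCat) (g g' f f' : edge C) e e' :
  g = g' -> f = f' -> cmp g f e = cmp g' f' e'.
Proof. intros -> ->; f_equal; apply proof_irrelevance. Qed.

Definition functor_id (C : SmallCat) : Functor C C.
Proof.
refine (Build_Functor C C (graph_id C) _ _).
- reflexivity.
- abstract (intros; now apply cmp_congr).
Defined.

Definition functor_comp (C D E : SmallCat) (G : Functor D E) (F : Functor C D) :
  Functor C E.
Proof.
refine (Build_Functor C E (graph_comp G F) _ _).
- abstract (intros x; simpl; now rewrite !f_idm).
- abstract (intros g f e e'; simpl;
    assert (h : src (on_edge F g) = tgt (on_edge F f))
      by (now rewrite on_src, on_tgt, e);
    rewrite (f_cmp F g f e h); apply f_cmp).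
Defined.

Definition Cat_cat : Category.
Proof.
refine {| obj := SmallCat; hom := Functor;
          idc := functor_id; compc := functor_comp |};
  abstract (intros; apply functor_eq; now apply graph_mor_ext).
Defined.

Lemma cat_pb_idm_proof (A B C : SmallCat) (F : Functor A C) (G : Functor B C)
    (x : vert (graph_pb F G)) :
  on_edge F (idm (fst (proj1_sig x))) = on_edge G (idm (snd (proj1_sig x))).
Proof. rewrite !f_idm; f_equal; exact (proj2_sig x). Qed.

Lemma cat_pb_cmp_proof (A B C : SmallCat) (F : Functor A C) (G : Functor B C)
    (g f : edge (graph_pb F G)) e1 e2 :
  on_edge F (cmp (fst (proj1_sig g)) (fst (proj1_sig f)) e1) =
  on_edge G (cmp (snd (proj1_sig g)) (snd (proj1_sig f)) e2).
Proof.
unshelve erewrite !f_cmp.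
- now rewrite on_src, on_tgt, e1.
- now rewrite on_src, on_tgt, e2.
- apply cmp_congr; [exact (proj2_sig g) | exact (proj2_sig f)].
Qed.

Definition cat_pb (A B C : SmallCat) (F : Functor A C) (G : Functor B C) : SmallCat.
Proof.
refine {| gr := graph_pb F G;
          idm := fun x : vert (graph_pb F G) =>
            (exist _ (idm (fst (proj1_sig x)), idm (snd (proj1_sig x)))
                   (cat_pb_idm_proof F G x) : edge (graph_pb F G));
          cmp := fun (g f : edge (graph_pb F G)) e =>
            (exist _ (cmp (fst (proj1_sig g)) (fst (proj1_sig f))
                        (f_equal (fun z => fst (proj1_sig z)) e),
                      cmp (snd (proj1_sig g)) (snd (proj1_sig f))
                        (f_equal (fun z => snd (proj1_sig z)) e))
                   (cat_pb_cmp_proof F G g f _ _) : edge (graph_pb F G)) |};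
  abstract (intros; apply sig_ext; simpl;
    rewrite ?src_idm, ?tgt_idm, ?src_cmp, ?tgt_cmp, ?cmp_idl, ?cmp_idr;
    first [ reflexivity | symmetry; apply surjective_pairing
          | apply f_equal2; apply cmp_assoc ]).
Defined.

Definition cat_pb1 (A B C : SmallCat) (F : Functor A C) (G : Functor B C) :
  Functor (cat_pb F G) A.
Proof.
refine (Build_Functor (cat_pb F G) A (graph_pb1 F G) _ _).
- reflexivity.
- abstract (intros; now apply cmp_congr).
Defined.

Definition cat_pb2 (A B C : SmallCat) (F : Functor A C) (G : Functor B C) :
  Functor (cat_pb F G) B.
Proof.
refine (Build_Functor (cat_pb F G) B (graph_pb2 F G) _ _).
- reflexivity.
- abstract (intros; now apply cmp_congr).
Defined.

Definition cat_pair (A B C : SmallCat) (F : Functor A C) (G : Functor B C)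
    (X : SmallCat) (U : Functor X A) (V : Functor X B)
    (e : functor_comp F U = functor_comp G V) : Functor X (cat_pb F G).
Proof.
refine (Build_Functor X (cat_pb F G)
  (graph_pair (f := F) (g := G) U V (f_equal (@fgr _ _) e)) _ _).
- abstract (intros x; apply sig_ext; simpl; now rewrite !f_idm).
- abstract (intros g f h h'; apply sig_ext; simpl; f_equal; apply f_cmp).
Defined.

Arguments cat_pair {A B C F G X} U V e.

Lemma cat_pb_ext (A B C : SmallCat) (F : Functor A C) (G : Functor B C)
    (X : SmallCat) (W W' : Functor X (cat_pb F G)) :
  functor_comp (cat_pb1 F G) W = functor_comp (cat_pb1 F G) W' ->
  functor_comp (cat_pb2 F G) W = functor_comp (cat_pb2 F G) W' -> W = W'.
Proof.
intros e1 e2; apply (f_equal (@fgr _ _)) in e1, e2; apply functor_eq.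
exact (graph_pb_ext (f := F) (g := G) e1 e2).
Qed.

Definition CAT : PbCategory.
Proof.
refine {| pb_cat := Cat_cat; pb := cat_pb;
          pb1 := cat_pb1; pb2 := cat_pb2; pb_pair := @cat_pair |}.
- abstract (intros A B C F G; apply functor_eq, graph_mor_ext;
            intros [[a b] e]; exact e).
- abstract (intros; apply functor_eq; now apply graph_mor_ext).
- abstract (intros; apply functor_eq; now apply graph_mor_ext).
- exact cat_pb_ext.
Defined.

(** Only affects the order in which conversion unfolds constants; checking
    [fgr (functor_comp G F)] against [graph_comp G F] under nested pullbacks
    is otherwise exponential. *)
Strategy 100 [graph_id graph_comp graph_pb graph_pb1 graph_pb2 graph_pair].
Strategy 50 [functor_id functor_comp cat_pb cat_pb1 cat_pb2 cat_pair].

Definition cat_prod (A B : SmallCat) : SmallCat.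
Proof.
refine {| gr := {| vert := (vert A * vert B)%type; edge := (edge A * edge B)%type;
                   src := fun x => (src (fst x), src (snd x));
                   tgt := fun x => (tgt (fst x), tgt (snd x)) |};
          idm := fun x => (idm (fst x), idm (snd x));
          cmp := fun g f e => (cmp (fst g) (fst f) (f_equal fst e),
                               cmp (snd g) (snd f) (f_equal snd e)) |};
  abstract (intros; simpl;
    rewrite ?src_idm, ?tgt_idm, ?src_cmp, ?tgt_cmp, ?cmp_idl, ?cmp_idr;
    first [ reflexivity | symmetry; apply surjective_pairing
          | apply f_equal2; apply cmp_assoc ]).
Defined.

Definition cat_prod_pair (X A B : SmallCat) (F : Functor X A) (G : Functor X B) :
  Functor X (cat_prod A B).
Proof.
refine (Build_Functor X (cat_prod A B)
  (Build_GraphMor X (cat_prod A B)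
    (fun x => (on_vert F x, on_vert G x))
    (fun x => (on_edge F x, on_edge G x))
    (fun x => f_equal2 (fun a b => (a, b)) (on_src F x) (on_src G x))
    (fun x => f_equal2 (fun a b => (a, b)) (on_tgt F x) (on_tgt G x))) _ _).
- abstract (intros x; simpl; now rewrite !f_idm).
- abstract (intros g f e e'; simpl; f_equal; apply f_cmp).
Defined.

Definition cat_prod_map (A B C D : SmallCat) (F : Functor A C) (G : Functor B D) :
  Functor (cat_prod A B) (cat_prod C D).
Proof.
refine (Build_Functor (cat_prod A B) (cat_prod C D)
  (Build_GraphMor (cat_prod A B) (cat_prod C D)
    (fun x => (on_vert F (fst x), on_vert G (snd x)))
    (fun x => (on_edge F (fst x), on_edge G (snd x)))
    (fun x => f_equal2 (fun a b => (a, b)) (on_src F (fst x)) (on_src G (snd x)))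
    (fun x => f_equal2 (fun a b => (a, b)) (on_tgt F (fst x)) (on_tgt G (snd x)))) _ _).
- abstract (intros x; simpl; now rewrite !f_idm).
- abstract (intros g f e e'; simpl; f_equal; apply f_cmp).
Defined.

Definition subcat (C : SmallCat) (P : vert C -> Prop) (Q : edge C -> Prop)
    (Qsrc : forall e, Q e -> P (src e)) (Qtgt : forall e, Q e -> P (tgt e))
    (Qid : forall x, P x -> Q (idm x))
    (Qcmp : forall g f e, Q g -> Q f -> Q (cmp g f e)) : SmallCat.
Proof.
refine {| gr := {| vert := sig P; edge := sig Q;
                   src := fun e => exist P (src (proj1_sig e)) (Qsrc _ (proj2_sig e));
                   tgt := fun e => exist P (tgt (proj1_sig e)) (Qtgt _ (proj2_sig e)) |};
          idm := fun x => exist Q (idm (proj1_sig x)) (Qid _ (proj2_sig x));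
          cmp := fun g f e =>
            exist Q (cmp (proj1_sig g) (proj1_sig f) (f_equal (@proj1_sig _ _) e))
                    (Qcmp _ _ _ (proj2_sig g) (proj2_sig f)) |};
  abstract (intros; apply sig_ext; simpl;
    auto using src_idm, tgt_idm, src_cmp, tgt_cmp, cmp_idl, cmp_idr, cmp_assoc).
Defined.

(** For [B : DblCat], [ic0 B] consists of the objects and vertical morphisms,
    [ic1 B] of the horizontal morphisms and squares under vertical
    composition, and [icm B] is horizontal composition. *)
Definition DblCat : Category := CatIn CAT.

(** The forgetful functor to [Cat(Graph)] forgets vertical composition and
    vertical identities.  It applies [fgr] to all the structure functors,
    using that the pullbacks chosen in [CAT] and [GRAPH] agree. *)
Definition Ubar_ob (B : DblCat) : CatIn GRAPH.
Proof.
refine (Build_IntCat GRAPH (gr (ic0 B)) (gr (ic1 B))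
          (fgr (ics B)) (fgr (ict B)) (fgr (ici B)) (fgr (icm B)) _ _ _ _ _ _ _).
- exact (f_equal (@fgr _ _) (ics_i B)).
- exact (f_equal (@fgr _ _) (ict_i B)).
- exact (f_equal (@fgr _ _) (ics_m B)).
- exact (f_equal (@fgr _ _) (ict_m B)).
- intros e.
  pose (e' := functor_eq (ics B ∘ idc (ic1 B)) (ict B ∘ (ici B ∘ ics B)) e).
  rewrite (proof_irrelevance _ e (f_equal (@fgr _ _) e')).
  exact (f_equal (@fgr _ _) (icm_idr B e')).
- intros e.
  pose (e' := functor_eq (ics B ∘ (ici B ∘ ict B)) (ict B ∘ idc (ic1 B)) e).
  rewrite (proof_irrelevance _ e (f_equal (@fgr _ _) e')).
  exact (f_equal (@fgr _ _) (icm_idl B e')).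
- intros p q e1 e2 e3.
  pose (P := pb1 (ics B ∘ pb2 (ics B) (ict B)) (ict B)).
  pose (Q := pb2 (ics B ∘ pb2 (ics B) (ict B)) (ict B)).
  pose (e1' := functor_eq (ics B ∘ (icm B ∘ P)) (ict B ∘ Q) e1).
  pose (e2' := functor_eq (ics B ∘ (pb2 (ics B) (ict B) ∘ P)) (ict B ∘ Q) e2).
  rewrite (proof_irrelevance _ e1 (f_equal (@fgr _ _) e1')).
  revert e3.
  rewrite (proof_irrelevance _ e2 (f_equal (@fgr _ _) e2')).
  intros e3.
  pose (e3' := functor_eq (ics B ∘ (pb1 (ics B) (ict B) ∘ P))
                 (ict B ∘ (icm B ∘ pb_pair (pb2 (ics B) (ict B) ∘ P) Q e2')) e3).
  rewrite (proof_irrelevance _ e3 (f_equal (@fgr _ _) e3')).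
  exact (f_equal (@fgr _ _) (icm_assoc B e1' e2' e3')).
Defined.

Definition Ubar (A B : DblCat) (F : hom A B) : hom (Ubar_ob A) (Ubar_ob B).
Proof.
refine (Build_IntFunctor (Ubar_ob A) (Ubar_ob B)
          (fgr (if0 F)) (fgr (if1 F)) _ _ _ _).
- exact (f_equal (@fgr _ _) (if_s F)).
- exact (f_equal (@fgr _ _) (if_t F)).
- exact (f_equal (@fgr _ _) (if_i F)).
- intros e.
  pose (e' := functor_eq (ics B ∘ (if1 F ∘ pb1 (ics A) (ict A)))
                (ict B ∘ (if1 F ∘ pb2 (ics A) (ict A))) e).
  rewrite (proof_irrelevance _ e (f_equal (@fgr _ _) e')).
  exact (f_equal (@fgr _ _) (if_m F e')).
Defined.

(** The free category monad [M] on [Graph] induces a 2-monad on [CatIn GRAPH]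
    whose strict algebras and strict morphisms are double categories and
    double functors, with forgetful functor [Ubar].  The induced model
    structure is lifted along [Ubar] from the trivial one, whose weak
    equivalences and fibrations are the equivalences and the isofibrations of
    the 2-category [CatIn GRAPH]. *)
Definition Mbar_weq (A B : DblCat) (F : hom A B) : Prop :=
  is_equivalence (Ubar F).

Definition Mbar_fib (A B : DblCat) (F : hom A B) : Prop :=
  is_isofibration (Ubar F).

Definition Mbar_model_structure : ModelStructure DblCat :=
  model_structure_of DblCat Mbar_weq Mbar_fib.

Definition cat_surjective (C D : SmallCat) (F : Functor C D) : Prop :=
  (forall y : vert D, exists x : vert C, on_vert F x = y) /\
  (forall (x x' : vert C) (k : edge D),
      src k = on_vert F x -> tgt k = on_vert F x' ->
      exists l : edge C, src l = x /\ tgt l = x' /\ on_edge F l = k).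

(** The lifting form of "[p] becomes an epimorphism after the Yoneda embedding
    and sheafification for the topology whose covers are single categorically
    surjective functors". *)
Definition tau'_epi (E B : SmallCat) (p : Functor E B) : Prop :=
  forall (X : SmallCat) (g : Functor X B),
    exists (U : SmallCat) (f : Functor U X) (u : Functor U E),
      cat_surjective f /\ functor_comp p u = functor_comp g f.

Definition hpair (B : DblCat) (x y : vert (ic1 B))
    (e : on_vert (ics B) x = on_vert (ict B) y) : vert (cat_pb (ics B) (ict B)) :=
  exist _ (x, y) e.

Definition hpair_sq (B : DblCat) (x y : edge (ic1 B))
    (e : on_edge (ics B) x = on_edge (ict B) y) : edge (cat_pb (ics B) (ict B)) :=
  exist _ (x, y) e.

Definition hcomp (B : DblCat) (x y : vert (ic1 B))
    (e : on_vert (ics B) x = on_vert (ict B) y) : vert (ic1 B) :=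
  on_vert (icm B) (hpair B x y e).

Definition hcomp_sq (B : DblCat) (x y : edge (ic1 B))
    (e : on_edge (ics B) x = on_edge (ict B) y) : edge (ic1 B) :=
  on_edge (icm B) (hpair_sq B x y e).

Definition hinv (B : DblCat) (x : vert (ic1 B)) : Prop :=
  exists (y : vert (ic1 B))
         (e : on_vert (ics B) x = on_vert (ict B) y)
         (e' : on_vert (ics B) y = on_vert (ict B) x),
    hcomp B x y e = on_vert (ici B) (on_vert (ict B) x) /\
    hcomp B y x e' = on_vert (ici B) (on_vert (ics B) x).

Definition hinv_sq (B : DblCat) (x : edge (ic1 B)) : Prop :=
  exists (y : edge (ic1 B))
         (e : on_edge (ics B) x = on_edge (ict B) y)
         (e' : on_edge (ics B) y = on_edge (ict B) x),
    hcomp_sq B x y e = on_edge (ici B) (on_edge (ict B) x) /\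
    hcomp_sq B y x e' = on_edge (ici B) (on_edge (ics B) x).

Lemma hcomp_congr (B : DblCat) x x' y y' e e' :
  x = x' -> y = y' -> hcomp B x y e = hcomp B x' y' e'.
Proof. intros -> ->; f_equal; apply proof_irrelevance. Qed.

Lemma hcomp_s (B : DblCat) x y e :
  on_vert (ics B) (hcomp B x y e) = on_vert (ics B) y.
Proof.
exact (f_equal (fun k : Functor _ _ => on_vert k (hpair B x y e)) (ics_m B)).
Qed.

Lemma hcomp_t (B : DblCat) x y e :
  on_vert (ict B) (hcomp B x y e) = on_vert (ict B) x.
Proof.
exact (f_equal (fun k : Functor _ _ => on_vert k (hpair B x y e)) (ict_m B)).
Qed.

Lemma hid_s (B : DblCat) x : on_vert (ics B) (on_vert (ici B) x) = x.
Proof. exact (f_equal (fun k : Functor _ _ => on_vert k x) (ics_i B)). Qed.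

Lemma hid_t (B : DblCat) x : on_vert (ict B) (on_vert (ici B) x) = x.
Proof. exact (f_equal (fun k : Functor _ _ => on_vert k x) (ict_i B)). Qed.

Lemma hcomp_idr (B : DblCat) x e :
  hcomp B x (on_vert (ici B) (on_vert (ics B) x)) e = x.
Proof.
assert (k : ics B ∘ idc (ic1 B) = ict B ∘ (ici B ∘ ics B)).
{ now rewrite compc_idr, compc_assoc, ict_i, compc_idl. }
pose proof (f_equal (fun k : Functor _ _ => on_vert k x) (icm_idr B k)) as h.
rewrite <- h at 3; now apply (f_equal (on_vert (icm B))), sig_ext.
Qed.

Lemma hcomp_idl (B : DblCat) x e :
  hcomp B (on_vert (ici B) (on_vert (ict B) x)) x e = x.
Proof.
assert (k : ics B ∘ (ici B ∘ ict B) = ict B ∘ idc (ic1 B)).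
{ now rewrite compc_idr, compc_assoc, ics_i, compc_idl. }
pose proof (f_equal (fun k : Functor _ _ => on_vert k x) (icm_idl B k)) as h.
rewrite <- h at 3; now apply (f_equal (on_vert (icm B))), sig_ext.
Qed.

Lemma hcomp_assoc (B : DblCat) x y z e1 e2 e3 e4 :
  hcomp B (hcomp B x y e1) z e2 = hcomp B x (hcomp B y z e3) e4.
Proof.
pose (xyz := exist _ (hpair B x y e1, z) e3 :
  vert (cat_pb (functor_comp (ics B) (cat_pb2 (ics B) (ict B))) (ict B))).
pose proof (f_equal (fun k : Functor _ _ => on_vert k xyz)
              (icm_assoc B (ic_assoc_eq1 B) (ic_assoc_eq2 B)
                 (ic_assoc_eq3 B (ic_assoc_eq2 B)))) as h.
etransitivity; [| etransitivity; [exact h |]].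
- now apply (f_equal (on_vert (icm B))), sig_ext.
- apply (f_equal (on_vert (icm B))), sig_ext; apply (f_equal (fun w => (x, w))).
  now apply (f_equal (on_vert (icm B))), sig_ext.
Qed.

Lemma hinv_unique (B : DblCat) x y y' e1 e2 e1' e2' :
  hcomp B x y e1 = on_vert (ici B) (on_vert (ict B) x) ->
  hcomp B y x e2 = on_vert (ici B) (on_vert (ics B) x) ->
  hcomp B x y' e1' = on_vert (ici B) (on_vert (ict B) x) ->
  hcomp B y' x e2' = on_vert (ici B) (on_vert (ics B) x) ->
  y = y'.
Proof.
intros h1 h2 h1' h2'.
assert (k : on_vert (ics B) y = on_vert (ict B) (hcomp B x y' e1'))
  by now rewrite hcomp_t.
assert (k' : on_vert (ics B) (hcomp B y x e2) = on_vert (ict B) y')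
  by now rewrite hcomp_s.
pose proof (hcomp_assoc B y x y' e2 k' e1' k) as h.
transitivity (hcomp B y (hcomp B x y' e1') k).
- revert k h; rewrite h1'; intros k h.
  transitivity (hcomp B y (on_vert (ici B) (on_vert (ics B) y))
                  (eq_sym (hid_t B (on_vert (ics B) y)))).
  + symmetry; apply hcomp_idr.
  + apply hcomp_congr; [reflexivity | now rewrite e2].
- rewrite <- h; revert k' h; rewrite h2; intros k' h.
  transitivity (hcomp B (on_vert (ici B) (on_vert (ict B) y')) y'
                  (hid_s B (on_vert (ict B) y'))).
  + apply hcomp_congr; [now rewrite e1' | reflexivity].
  + apply hcomp_idl.
Qed.

Lemma hcomp_sq_src (B : DblCat) x y e e' :
  src (hcomp_sq B x y e) = hcomp B (src x) (src y) e'.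
Proof.
unfold hcomp_sq; rewrite on_src; now apply (f_equal (on_vert (icm B))), sig_ext.
Qed.

Lemma hcomp_sq_tgt (B : DblCat) x y e e' :
  tgt (hcomp_sq B x y e) = hcomp B (tgt x) (tgt y) e'.
Proof.
unfold hcomp_sq; rewrite on_tgt; now apply (f_equal (on_vert (icm B))), sig_ext.
Qed.

Lemma hcomp_sq_idm (B : DblCat) x y e e' :
  hcomp_sq B (idm x) (idm y) e = idm (hcomp B x y e').
Proof.
unfold hcomp; rewrite <- f_idm; now apply (f_equal (on_edge (icm B))), sig_ext.
Qed.

Lemma hcomp_sq_cmp (B : DblCat) x y x' y' e1 e2 e3 e4 e e' :
  hcomp_sq B (cmp x' x e1) (cmp y' y e2) e =
  cmp (hcomp_sq B x' y' e3) (hcomp_sq B x y e4) e'.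
Proof.
assert (k : src (hpair_sq B x' y' e3) = tgt (hpair_sq B x y e4)).
{ apply sig_ext; simpl; now rewrite e1, e2. }
refine (eq_trans _ (f_cmp (icm B) (hpair_sq B x' y' e3) (hpair_sq B x y e4) k e')).
apply (f_equal (on_edge (icm B))), sig_ext; simpl.
apply f_equal2; apply (f_equal (cmp _ _)), proof_irrelevance.
Qed.

Lemma hinv_src (B : DblCat) x : hinv_sq B x -> hinv B (src x).
Proof.
intros (y & e & e' & h & h').
assert (k : on_vert (ics B) (src x) = on_vert (ict B) (src y))
  by now rewrite <- !on_src, e.
assert (k' : on_vert (ics B) (src y) = on_vert (ict B) (src x))
  by now rewrite <- !on_src, e'.
exists (src y), k, k'; split.
- now rewrite <- hcomp_sq_src with (e := e), h, !on_src.
- now rewrite <- hcomp_sq_src with (e := e'), h', !on_src.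
Qed.

Lemma hinv_tgt (B : DblCat) x : hinv_sq B x -> hinv B (tgt x).
Proof.
intros (y & e & e' & h & h').
assert (k : on_vert (ics B) (tgt x) = on_vert (ict B) (tgt y))
  by now rewrite <- !on_tgt, e.
assert (k' : on_vert (ics B) (tgt y) = on_vert (ict B) (tgt x))
  by now rewrite <- !on_tgt, e'.
exists (tgt y), k, k'; split.
- now rewrite <- hcomp_sq_tgt with (e := e), h, !on_tgt.
- now rewrite <- hcomp_sq_tgt with (e := e'), h', !on_tgt.
Qed.

Lemma hinv_idm (B : DblCat) x : hinv B x -> hinv_sq B (idm x).
Proof.
intros (y & e & e' & h & h').
assert (k : on_edge (ics B) (idm x) = on_edge (ict B) (idm y))
  by now rewrite !f_idm, e.
assert (k' : on_edge (ics B) (idm y) = on_edge (ict B) (idm x))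
  by now rewrite !f_idm, e'.
exists (idm y), k, k'; split.
- now rewrite hcomp_sq_idm with (e' := e), h, !f_idm.
- now rewrite hcomp_sq_idm with (e' := e'), h', !f_idm.
Qed.

Lemma functor_cmp_congr (C D : SmallCat) (F G : Functor C D) g f g' f' e e' :
  on_edge F g = on_edge G g' -> on_edge F f = on_edge G f' ->
  on_edge F (cmp g f e) = on_edge G (cmp g' f' e').
Proof.
intros hg hf.
assert (k : src (on_edge F g) = tgt (on_edge F f)) by now rewrite on_src, on_tgt, e.
assert (k' : src (on_edge G g') = tgt (on_edge G f'))
  by now rewrite on_src, on_tgt, e'.
rewrite (f_cmp F _ _ e k), (f_cmp G _ _ e' k'); now apply cmp_congr.
Qed.

Lemma hinv_cmp (B : DblCat) x' x e :
  hinv_sq B x' -> hinv_sq B x -> hinv_sq B (cmp x' x e).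
Proof.
intros (y' & l & l' & h & h') (y & k & k' & g & g').
assert (e' : src y' = tgt y).
{ assert (l1 : on_vert (ics B) (src x') = on_vert (ict B) (src y'))
    by now rewrite <- !on_src, l.
  assert (l2 : on_vert (ics B) (src y') = on_vert (ict B) (src x'))
    by now rewrite <- !on_src, l'.
  assert (k1 : on_vert (ics B) (src x') = on_vert (ict B) (tgt y))
    by now rewrite e, <- !on_tgt, k.
  assert (k2 : on_vert (ics B) (tgt y) = on_vert (ict B) (src x'))
    by now rewrite e, <- !on_tgt, k'.
  apply (hinv_unique B (src x') (src y') (tgt y) l1 l2 k1 k2).
  - now rewrite <- hcomp_sq_src with (e := l), h, !on_src.
  - now rewrite <- hcomp_sq_src with (e := l'), h', !on_src.
  - revert k1; rewrite e; intros k1.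
    now rewrite <- hcomp_sq_tgt with (e := k), g, !on_tgt.
  - revert k2; rewrite e; intros k2.
    now rewrite <- hcomp_sq_tgt with (e := k'), g', !on_tgt. }
exists (cmp y' y e').
assert (m : on_edge (ics B) (cmp x' x e) = on_edge (ict B) (cmp y' y e'))
  by now apply functor_cmp_congr.
assert (m' : on_edge (ics B) (cmp y' y e') = on_edge (ict B) (cmp x' x e))
  by now apply functor_cmp_congr.
exists m, m'; split.
- assert (n : src (hcomp_sq B x' y' l) = tgt (hcomp_sq B x y k)).
  { now rewrite h, g, !on_src, !on_tgt, e. }
  rewrite (hcomp_sq_cmp B _ _ _ _ e e' l k m n).
  change (on_edge (ici B) (on_edge (ict B) (cmp x' x e)))
    with (on_edge (functor_comp (ici B) (ict B)) (cmp x' x e)).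
  unshelve erewrite f_cmp; [| now apply cmp_congr].
  now rewrite !on_src, !on_tgt, e.
- assert (n : src (hcomp_sq B y' x' l') = tgt (hcomp_sq B y x k')).
  { now rewrite h', g', !on_src, !on_tgt, e. }
  rewrite (hcomp_sq_cmp B _ _ _ _ e' e l' k' m' n).
  change (on_edge (ici B) (on_edge (ics B) (cmp x' x e)))
    with (on_edge (functor_comp (ici B) (ics B)) (cmp x' x e)).
  unshelve erewrite f_cmp; [| now apply cmp_congr].
  now rewrite !on_src, !on_tgt, e.
Qed.

(** The subcategory [iso(B)_1] of [B_1]. *)
Definition iso1 (B : DblCat) : SmallCat :=
  subcat (ic1 B) (hinv B) (hinv_sq B)
    (@hinv_src B) (@hinv_tgt B) (@hinv_idm B) (@hinv_cmp B).

Definition iso1_incl (B : DblCat) : Functor (iso1 B) (ic1 B).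
Proof.
refine (Build_Functor (iso1 B) (ic1 B)
  (Build_GraphMor (iso1 B) (ic1 B)
    (fun x => proj1_sig x) (fun x => proj1_sig x)
    (fun x => eq_refl) (fun x => eq_refl)) _ _).
- reflexivity.
- abstract (intros; now apply cmp_congr).
Defined.

Lemma if_m_wd (E : PbCategory) (A B : IntCat E) (F : IntFunctor A B) :
  ics B ∘ (if1 F ∘ pb1 (ics A) (ict A)) = ict B ∘ (if1 F ∘ pb2 (ics A) (ict A)).
Proof. rewrite !compc_assoc, if_s, if_t, <- !compc_assoc; f_equal; apply pb_comm. Qed.

Lemma hcomp_functor (A B : DblCat) (F : hom A B) x y e e' :
  on_vert (if1 F) (hcomp A x y e) =
  hcomp B (on_vert (if1 F) x) (on_vert (if1 F) y) e'.
Proof.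
refine (eq_trans (f_equal (fun k : Functor _ _ => on_vert k (hpair A x y e))
                    (if_m F (if_m_wd F))) _).
now apply (f_equal (on_vert (icm B))), sig_ext.
Qed.

Lemma hcomp_sq_functor (A B : DblCat) (F : hom A B) x y e e' :
  on_edge (if1 F) (hcomp_sq A x y e) =
  hcomp_sq B (on_edge (if1 F) x) (on_edge (if1 F) y) e'.
Proof.
refine (eq_trans (f_equal (fun k : Functor _ _ => on_edge k (hpair_sq A x y e))
                    (if_m F (if_m_wd F))) _).
now apply (f_equal (on_edge (icm B))), sig_ext.
Qed.

Lemma hinv_functor (A B : DblCat) (F : hom A B) x :
  hinv A x -> hinv B (on_vert (if1 F) x).
Proof.
pose (vs := fun z => f_equal (fun k : Functor _ _ => on_vert k z) (if_s F)).
pose (vt := fun z => f_equal (fun k : Functor _ _ => on_vert k z) (if_t F)).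
pose (vi := fun z => f_equal (fun k : Functor _ _ => on_vert k z) (if_i F)).
simpl in vs, vt, vi.
intros (y & e & e' & h & h').
assert (k : on_vert (ics B) (on_vert (if1 F) x) = on_vert (ict B) (on_vert (if1 F) y))
  by now rewrite vs, vt, e.
assert (k' : on_vert (ics B) (on_vert (if1 F) y) = on_vert (ict B) (on_vert (if1 F) x))
  by now rewrite vs, vt, e'.
exists (on_vert (if1 F) y), k, k'; split.
- now rewrite <- hcomp_functor with (e := e), h, vi, vt.
- now rewrite <- hcomp_functor with (e := e'), h', vi, vs.
Qed.

Lemma hinv_sq_functor (A B : DblCat) (F : hom A B) x :
  hinv_sq A x -> hinv_sq B (on_edge (if1 F) x).
Proof.
pose (vs := fun z => f_equal (fun k : Functor _ _ => on_edge k z) (if_s F)).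
pose (vt := fun z => f_equal (fun k : Functor _ _ => on_edge k z) (if_t F)).
pose (vi := fun z => f_equal (fun k : Functor _ _ => on_edge k z) (if_i F)).
simpl in vs, vt, vi.
intros (y & e & e' & h & h').
assert (k : on_edge (ics B) (on_edge (if1 F) x) = on_edge (ict B) (on_edge (if1 F) y))
  by now rewrite vs, vt, e.
assert (k' : on_edge (ics B) (on_edge (if1 F) y) = on_edge (ict B) (on_edge (if1 F) x))
  by now rewrite vs, vt, e'.
exists (on_edge (if1 F) y), k, k'; split.
- now rewrite <- hcomp_sq_functor with (e := e), h, vi, vt.
- now rewrite <- hcomp_sq_functor with (e := e'), h', vi, vs.
Qed.

(** The restriction [iso(F)_1] of [F_1]. *)
Definition iso1_map_gr (A B : DblCat) (F : hom A B) : GraphMor (iso1 A) (iso1 B).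
Proof.
refine (Build_GraphMor (iso1 A) (iso1 B)
  (fun x => exist (hinv B) (on_vert (if1 F) (proj1_sig x))
              (hinv_functor F (proj2_sig x)))
  (fun x => exist (hinv_sq B) (on_edge (if1 F) (proj1_sig x))
              (hinv_sq_functor F (proj2_sig x))) _ _).
- abstract (intros x; apply sig_ext; simpl; apply on_src).
- abstract (intros x; apply sig_ext; simpl; apply on_tgt).
Defined.

Definition iso1_map (A B : DblCat) (F : hom A B) : Functor (iso1 A) (iso1 B).
Proof.
refine (Build_Functor (iso1 A) (iso1 B) (iso1_map_gr F) _ _).
- abstract (intros x; apply sig_ext; simpl; apply f_idm).
- abstract (intros g f e e'; apply sig_ext; simpl; apply f_cmp).
Defined.

Definition iso1_s (B : DblCat) : Functor (iso1 B) (ic0 B) :=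
  functor_comp (ics B) (iso1_incl B).

Definition iso1_t (B : DblCat) : Functor (iso1 B) (ic0 B) :=
  functor_comp (ict B) (iso1_incl B).

(** The category [(P_F)_0] of pairs [(a, x)] with [F a = t x]. *)
Definition PF0 (A B : DblCat) (F : hom A B) : SmallCat :=
  cat_pb (if0 F) (iso1_t B).

Definition PF0_proj (A B : DblCat) (F : hom A B) : Functor (PF0 F) (iso1 B) :=
  cat_pb2 (if0 F) (iso1_t B).

Lemma rF0_comm (A B : DblCat) (F : hom A B) :
  functor_comp (if0 F) (iso1_t A) = functor_comp (iso1_t B) (iso1_map F).
Proof.
pose proof (if_t F) as h.
apply functor_eq, graph_mor_ext; intros x; symmetry.
- exact (f_equal (fun k : Functor _ _ => on_vert k (proj1_sig x)) h).
- exact (f_equal (fun k : Functor _ _ => on_edge k (proj1_sig x)) h).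
Qed.

Definition rF0 (A B : DblCat) (F : hom A B) : Functor (iso1 A) (PF0 F) :=
  cat_pair (iso1_t A) (iso1_map F) (rF0_comm F).

Definition fully_faithful (A B : DblCat) (F : hom A B) : Prop :=
  is_pullback (E := CAT)
    (cat_prod_map (if0 F) (if0 F)) (cat_prod_pair (ics B) (ict B))
    (cat_prod_pair (ics A) (ict A)) (if1 F).

Definition tau'_weq (A B : DblCat) (F : hom A B) : Prop :=
  tau'_epi (functor_comp (iso1_s B) (PF0_proj F)) /\ fully_faithful F.

Definition tau'_fib (A B : DblCat) (F : hom A B) : Prop := tau'_epi (rF0 F).

Definition tau'_model_structure : ModelStructure DblCat :=
  model_structure_of DblCat tau'_weq tau'_fib.

(* Main.v *)
Require Import Defs.
From Stdlib Require Import ClassicalEpsilon IndefiniteDescription ProofIrrelevance.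
From Stdlib Require Import FunctionalExtensionality PropExtensionality.

(** A functor is [tau']-epi exactly when its underlying graph morphism has a
    section: a section on vertices and on edges is what categorically
    surjective covers provide, and compatibility with composition is lost.
    On the other side, in internal categories in any category with pullbacks,
    an internal functor is an isofibration iff invertible generalised arrows
    lift along it with prescribed target, and an equivalence iff it is
    representably fully faithful and every object of the codomain is, naturally,
    isomorphic to an object in the image.  For graphs, these liftings are sections
    of [rF0 F] and of [s : PF0 F -> B_0], because the subcategory [iso1 B]
    represents the horizontally invertible arrows.  Full faithfulness is a
    pullback condition, and the forgetful functor from categories to graphs
    preserves and reflects pullbacks. *)

(** * Calculus of generalised arrows [hom X (ic1 A)] in an internal category *)

(* Total, with junk value [g] when [g] and [f] are not composable, so that
   terms carry no composability proofs. *)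
Definition mul {E : PbCategory} {A : IntCat E} {X : E}
    (g f : hom X (ic1 A)) : hom X (ic1 A) :=
  match excluded_middle_informative (ics A ∘ g = ict A ∘ f) with
  | left e => icm A ∘ pb_pair g f e
  | right _ => g
  end.

Notation "g ⋅ f" := (mul g f) (at level 45, right associativity) : cat_scope.

Lemma mulE {E : PbCategory} {A : IntCat E} {X : E} (g f : hom X (ic1 A)) e :
  g ⋅ f = icm A ∘ pb_pair g f e.
Proof.
unfold mul; destruct excluded_middle_informative as [e' | n]; [| contradiction].
now rewrite (proof_irrelevance _ e e').
Qed.

Lemma comp_sub {C : Category} {x y z : C} {g : hom y z} {f : hom x y} {h} :
  g ∘ f = h -> forall w (k : hom w x), g ∘ (f ∘ k) = h ∘ k.
Proof. intros <- w k; apply compc_assoc. Qed.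

Lemma mul_s {E : PbCategory} {A : IntCat E} {X : E} (g f : hom X (ic1 A)) :
  ics A ∘ g = ict A ∘ f -> ics A ∘ (g ⋅ f) = ics A ∘ f.
Proof.
intros e; rewrite (mulE g f e), (comp_sub (ics_m A)), <- compc_assoc.
now rewrite pb2_pair.
Qed.

Lemma mul_t {E : PbCategory} {A : IntCat E} {X : E} (g f : hom X (ic1 A)) :
  ics A ∘ g = ict A ∘ f -> ict A ∘ (g ⋅ f) = ict A ∘ g.
Proof.
intros e; rewrite (mulE g f e), (comp_sub (ict_m A)), <- compc_assoc.
now rewrite pb1_pair.
Qed.

(** Discharges composability side conditions: the ends of composites are reduced recursively to ends
    of their factors, which [congruence] compares using the hypotheses at hand. This is why later
    proofs first collect equations about sources and targets. *)
Ltac ends := repeat first [rewrite mul_s by ends | rewrite mul_t by ends]; congruence.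

Lemma pb_pair_pre {E : PbCategory} {A B C : E} {f : hom A C} {g : hom B C}
    {X Y : E} (u : hom X A) (v : hom X B) e (w : hom Y X) e' :
  pb_pair (f := f) (g := g) u v e ∘ w = pb_pair (u ∘ w) (v ∘ w) e'.
Proof.
apply pb_ext.
- now rewrite pb1_pair, compc_assoc, pb1_pair.
- now rewrite pb2_pair, compc_assoc, pb2_pair.
Qed.

Lemma mul_pre {E : PbCategory} {A : IntCat E} {X Y : E} (g f : hom X (ic1 A))
    (u : hom Y X) :
  ics A ∘ g = ict A ∘ f -> (g ⋅ f) ∘ u = (g ∘ u) ⋅ (f ∘ u).
Proof.
intros e.
assert (e' : ics A ∘ (g ∘ u) = ict A ∘ (f ∘ u)) by now rewrite !compc_assoc, e.
rewrite (mulE _ _ e), (mulE _ _ e'), <- (pb_pair_pre g f e u e').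
symmetry; apply compc_assoc.
Qed.

(** The two projections form the universal composable pair; this turns functoriality conditions on
    [icm] into equations about [⋅]. *)
Lemma mul_icm {E : PbCategory} (A : IntCat E) :
  icm A = pb1 (ics A) (ict A) ⋅ pb2 (ics A) (ict A).
Proof.
rewrite (mulE _ _ (pb_comm _ _)); transitivity (icm A ∘ idc _).
{ symmetry; apply compc_idr. }
f_equal; apply pb_ext.
- now rewrite pb1_pair, compc_idr.
- now rewrite pb2_pair, compc_idr.
Qed.

(** The axiom [icm_idl] is the case of the universal arrow [idc (ic1 A)]; precomposing with [f]
    gives the general case. The free [x] lets the law match any expression for the target. *)
Lemma mul_idl {E : PbCategory} {A : IntCat E} {X : E} (f : hom X (ic1 A)) x :
  ict A ∘ f = x -> (ici A ∘ x) ⋅ f = f.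
Proof.
intros <-.
assert (e : ics A ∘ (ici A ∘ ict A) = ict A ∘ idc (ic1 A)).
{ now rewrite compc_assoc, ics_i, compc_idl, compc_idr. }
transitivity (((ici A ∘ ict A) ⋅ idc _) ∘ f).
- now rewrite mul_pre, compc_idl, <- compc_assoc.
- now rewrite (mulE _ _ e), icm_idl, compc_idl.
Qed.

Lemma mul_idr {E : PbCategory} {A : IntCat E} {X : E} (f : hom X (ic1 A)) x :
  ics A ∘ f = x -> f ⋅ (ici A ∘ x) = f.
Proof.
intros <-.
assert (e : ics A ∘ idc (ic1 A) = ict A ∘ (ici A ∘ ics A)).
{ now rewrite compc_assoc, ict_i, compc_idl, compc_idr. }
transitivity ((idc _ ⋅ (ici A ∘ ics A)) ∘ f).
- now rewrite mul_pre, compc_idl, <- compc_assoc.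
- now rewrite (mulE _ _ e), icm_idr, compc_idl.
Qed.

(** The axiom [icm_assoc] concerns the universal composable triple; it is pulled back along the
    morphism classifying [h], [g], [f]. *)
Lemma mul_assoc {E : PbCategory} {A : IntCat E} {X : E} (h g f : hom X (ic1 A)) :
  ics A ∘ h = ict A ∘ g -> ics A ∘ g = ict A ∘ f -> (h ⋅ g) ⋅ f = h ⋅ g ⋅ f.
Proof.
intros e1 e2.
assert (e : (ics A ∘ pb2 (ics A) (ict A)) ∘ pb_pair h g e1 = ict A ∘ f).
{ now rewrite <- compc_assoc, pb2_pair. }
pose proof (ic_assoc_eq1 A) as k1.
pose proof (ic_assoc_eq2 A) as k2.
pose proof (ic_assoc_eq3 A k2) as k3.
pose proof (icm_assoc A k1 k2 k3) as k.
rewrite <- (mulE _ _ k1), <- (mulE _ _ k3), <- (mulE _ _ k2) in k.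
rewrite <- (mulE _ _ k2) in k3.
apply (f_equal (fun z => z ∘ pb_pair (pb_pair h g e1) f e)) in k.
rewrite !mul_pre, <- !compc_assoc, !pb1_pair, !pb2_pair in k by assumption.
now rewrite (mulE h g e1).
Qed.

Lemma map_mul {E : PbCategory} {A B : IntCat E} (F : IntFunctor A B) {X : E}
    (g f : hom X (ic1 A)) :
  ics A ∘ g = ict A ∘ f -> if1 F ∘ (g ⋅ f) = (if1 F ∘ g) ⋅ (if1 F ∘ f).
Proof.
intros e.
assert (k : ics B ∘ (if1 F ∘ pb1 (ics A) (ict A)) = ict B ∘ (if1 F ∘ pb2 (ics A) (ict A)))
  by apply if_m_wd.
rewrite (mulE _ _ e), compc_assoc, (if_m F k), <- (mulE _ _ k), mul_pre by exact k.
now rewrite <- !compc_assoc, pb1_pair, pb2_pair.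
Qed.

Lemma map_s {E : PbCategory} {A B : IntCat E} (F : IntFunctor A B) {X : E}
    (f : hom X (ic1 A)) : ics B ∘ (if1 F ∘ f) = if0 F ∘ (ics A ∘ f).
Proof. now rewrite compc_assoc, if_s, compc_assoc. Qed.

Lemma map_t {E : PbCategory} {A B : IntCat E} (F : IntFunctor A B) {X : E}
    (f : hom X (ic1 A)) : ict B ∘ (if1 F ∘ f) = if0 F ∘ (ict A ∘ f).
Proof. now rewrite compc_assoc, if_t, compc_assoc. Qed.

Lemma map_i {E : PbCategory} {A B : IntCat E} (F : IntFunctor A B) {X : E}
    (x : hom X (ic0 A)) : if1 F ∘ (ici A ∘ x) = ici B ∘ (if0 F ∘ x).
Proof. now rewrite compc_assoc, if_i, compc_assoc. Qed.

(** * Invertible arrows, natural transformations and conjugation *)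

Record is_inv {E : PbCategory} {A : IntCat E} {X : E} (g h : hom X (ic1 A)) : Prop := {
  inv_s : ics A ∘ g = ict A ∘ h;
  inv_t : ict A ∘ g = ics A ∘ h;
  inv_r : g ⋅ h = ici A ∘ (ict A ∘ g);
  inv_l : h ⋅ g = ici A ∘ (ics A ∘ g) }.

Lemma inv_sym {E : PbCategory} {A : IntCat E} {X : E} (g h : hom X (ic1 A)) :
  is_inv g h -> is_inv h g.
Proof.
intros [s t r l]; split; [now symmetry | now symmetry | now rewrite l, s | now rewrite r, t].
Qed.

Lemma inv_cancel {E : PbCategory} {A : IntCat E} {X : E} (g h f : hom X (ic1 A)) :
  is_inv g h -> ics A ∘ g = ict A ∘ f -> h ⋅ g ⋅ f = f.
Proof.
intros [s t r l] e; rewrite <- mul_assoc, l, e by auto; now apply mul_idl.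
Qed.

Lemma inv_cancel_r {E : PbCategory} {A : IntCat E} {X : E} (g h f : hom X (ic1 A)) :
  is_inv g h -> ict A ∘ g = ics A ∘ f -> (f ⋅ g) ⋅ h = f.
Proof.
intros [s t r l] e; rewrite mul_assoc, r, e by auto; now apply mul_idr.
Qed.

Lemma inv_pre {E : PbCategory} {A : IntCat E} {X Y : E} (g h : hom X (ic1 A)) (u : hom Y X) :
  is_inv g h -> is_inv (g ∘ u) (h ∘ u).
Proof.
intros [s t r l]; split.
- now rewrite !compc_assoc, s.
- now rewrite !compc_assoc, t.
- now rewrite <- mul_pre, r, !compc_assoc by auto.
- now rewrite <- mul_pre, l, !compc_assoc by auto.
Qed.

(** Naturality phrased with [⋅], free of composability proofs; [is_nat_nt] and [mk_nat] translate
    from and to [IntNat]. *)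
Record is_nat {E : PbCategory} {A B : IntCat E} (F G : IntFunctor A B)
    (n : hom (ic0 A) (ic1 B)) : Prop := {
  nat_s : ics B ∘ n = if0 F;
  nat_t : ict B ∘ n = if0 G;
  nat_mul : if1 G ⋅ (n ∘ ics A) = (n ∘ ict A) ⋅ if1 F }.

Lemma is_nat_nt {E : PbCategory} {A B : IntCat E} (F G : IntFunctor A B)
  (n : IntNat F G) : is_nat F G (nt n).
Proof.
assert (e : ics B ∘ if1 G = ict B ∘ (nt n ∘ ics A)) by now rewrite compc_assoc, nt_t, if_s.
assert (e' : ics B ∘ (nt n ∘ ict A) = ict B ∘ if1 F) by now rewrite compc_assoc, nt_s, if_t.
split; [apply nt_s | apply nt_t |].
rewrite (mulE _ _ e), (mulE _ _ e'); apply nt_nat.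
Qed.

Definition mk_nat {E : PbCategory} {A B : IntCat E} (F G : IntFunctor A B) n
    (h : is_nat F G n) : IntNat F G.
Proof.
refine {| nt := n; nt_s := nat_s _ _ _ h; nt_t := nat_t _ _ _ h |}.
abstract (intros e e'; rewrite <- !mulE; apply (nat_mul _ _ _ h)).
Defined.

Lemma nat_at {E : PbCategory} {A B : IntCat E} {F G : IntFunctor A B} {n}
    (h : is_nat F G n) {X} (x : hom X (ic1 A)) :
  (if1 G ∘ x) ⋅ (n ∘ (ics A ∘ x)) = (n ∘ (ict A ∘ x)) ⋅ (if1 F ∘ x).
Proof.
destruct h as [s t m].
rewrite !compc_assoc, <- !mul_pre, m; [reflexivity | | ].
- now rewrite compc_assoc, s, if_t.
- now rewrite compc_assoc, t, if_s.
Qed.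

Lemma nat_inv {E : PbCategory} {A B : IntCat E} (F G : IntFunctor A B) n n' :
  is_nat F G n -> is_inv n n' -> is_nat G F n'.
Proof.
intros [s t m] i; pose proof i as [is it ir il].
split; [congruence | congruence |].
pose proof (inv_pre _ _ (ics A) i) as i1; pose proof (inv_pre _ _ (ict A) i) as i2.
assert (k1 : ict B ∘ (n' ∘ ics A) = if0 F ∘ ics A) by now rewrite compc_assoc, <- is, s.
assert (k2 : ics B ∘ (n' ∘ ict A) = if0 G ∘ ict A) by now rewrite compc_assoc, <- it, t.
assert (k3 : ics B ∘ (n ∘ ics A) = if0 F ∘ ics A) by now rewrite compc_assoc, s.
assert (k4 : ict B ∘ (n ∘ ics A) = if0 G ∘ ics A) by now rewrite compc_assoc, t.
assert (k5 : ics B ∘ (n ∘ ict A) = if0 F ∘ ict A) by now rewrite compc_assoc, s.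
pose proof (if_s F); pose proof (if_t F); pose proof (if_s G); pose proof (if_t G).
(* Insert [n' ⋅ n] at the target end; naturality of [n] then moves [n] past [if1 F], where it
   cancels against the [n'] at the source end. *)
rewrite <- (inv_cancel _ _ (if1 F ⋅ (n' ∘ ics A)) i2).
2: ends.
rewrite <- (mul_assoc (n ∘ ict A)), <- m, inv_cancel_r by ends; reflexivity.
Qed.

(** By [nat_inv] an inverse of the underlying arrow is automatically natural, so invertibility is a
    property of [nt a] alone. *)
Lemma invertible_2cellP {E : PbCategory} {A B : IntCat E} {F G : IntFunctor A B}
    (a : IntNat F G) : invertible_2cell a <-> exists n, is_inv (nt a) n.
Proof.
split.
- intros (b & h1 & h2); exists (nt b).
  pose proof (nt_s a); pose proof (nt_t a); pose proof (nt_s b); pose proof (nt_t b).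
  assert (e1 : ics B ∘ nt b = ict B ∘ nt a) by congruence.
  assert (e2 : ics B ∘ nt a = ict B ∘ nt b) by congruence.
  specialize (h1 e1); specialize (h2 e2); rewrite <- !mulE in *.
  split; congruence.
- intros (n & i); exists (mk_nat _ _ _ (nat_inv _ _ _ _ (is_nat_nt _ _ a) i)).
  simpl; destruct i as [s t r l]; pose proof (nt_s a); pose proof (nt_t a).
  split; intros e; rewrite <- mulE; congruence.
Qed.

Definition mk_functor {E : PbCategory} {A B : IntCat E}
    (f0 : hom (ic0 A) (ic0 B)) (f1 : hom (ic1 A) (ic1 B))
    (fs : ics B ∘ f1 = f0 ∘ ics A) (ft : ict B ∘ f1 = f0 ∘ ict A)
    (fi : f1 ∘ ici A = ici B ∘ f0)
    (fm : f1 ∘ icm A = (f1 ∘ pb1 (ics A) (ict A)) ⋅ (f1 ∘ pb2 (ics A) (ict A))) :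
  IntFunctor A B.
Proof.
refine {| if0 := f0; if1 := f1; if_s := fs; if_t := ft; if_i := fi |}.
abstract (intros e; rewrite <- mulE; exact fm).
Defined.

(** Transport of structure: [H'] sends an arrow [x] to [n' ⋅ H x ⋅ n], with [n'] taken at the target
    of [x] and [n] at its source, so that [n] is natural by construction. *)
Lemma conj_functor {E : PbCategory} {X A : IntCat E} (H : IntFunctor X A) n n' :
  is_inv n n' -> ict A ∘ n = if0 H -> exists H', is_nat H' H n.
Proof.
intros i t0; pose proof i as [is it ir il].
pose proof (if_s H) as Hs; pose proof (if_t H) as Ht.
pose proof (inv_pre _ _ (ics X) i) as i1; pose proof (inv_pre _ _ (ict X) i) as i2.
assert (k1 : ict A ∘ (n ∘ ics X) = if0 H ∘ ics X) by now rewrite compc_assoc, t0.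
assert (k2 : ics A ∘ (n' ∘ ict X) = if0 H ∘ ict X) by now rewrite compc_assoc, <- it, t0.
assert (k3 : ict A ∘ (n ∘ ict X) = if0 H ∘ ict X) by now rewrite compc_assoc, t0.
unshelve eexists (mk_functor (ics A ∘ n) ((n' ∘ ict X) ⋅ if1 H ⋅ (n ∘ ics X)) _ _ _ _).
- rewrite !mul_s by ends; apply compc_assoc.
- rewrite !mul_t by ends; now rewrite compc_assoc, is.
- rewrite !mul_pre by ends.
  rewrite <- !compc_assoc, ics_i, ict_i, !compc_idr, if_i, mul_idl by exact t0; exact il.
- rewrite !mul_pre by ends.
  rewrite <- !compc_assoc, ics_m, ict_m, (mul_icm X).
  set (p := pb1 _ _); set (q := pb2 _ _).
  assert (e : ics X ∘ p = ict X ∘ q) by apply pb_comm.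
  rewrite map_mul by exact e.
  pose proof (map_s H p) as Hps; pose proof (map_t H p) as Hpt.
  pose proof (map_s H q) as Hqs; pose proof (map_t H q) as Hqt.
  pose proof (inv_pre _ _ (ics X ∘ p) i) as j1; pose proof (inv_pre _ _ (ict X ∘ q) i) as j2.
  assert (l1 : ics A ∘ (n' ∘ (ict X ∘ p)) = if0 H ∘ (ict X ∘ p)) by now rewrite compc_assoc, <- it, t0.
  assert (l2 : ict A ∘ (n ∘ (ics X ∘ q)) = if0 H ∘ (ics X ∘ q)) by now rewrite compc_assoc, t0.
  assert (l3 : ict A ∘ (n ∘ (ics X ∘ p)) = if0 H ∘ (ict X ∘ q)) by now rewrite compc_assoc, t0, e.
  assert (l4 : ics A ∘ (n' ∘ (ict X ∘ q)) = if0 H ∘ (ict X ∘ q)) by now rewrite compc_assoc, <- it, t0.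
  assert (l5 : ict A ∘ (n' ∘ (ict X ∘ q)) = ics A ∘ (n ∘ (ics X ∘ p))) by now rewrite e, !compc_assoc, is.
  rewrite e in *.
  rewrite !mul_assoc by ends.
  (* Between the two conjugated factors, [n] meets [n'] at the common object of [p] and [q], and the
     two cancel. *)
  rewrite (inv_cancel (n' ∘ (ict X ∘ q))) by (first [now apply inv_sym | ends]).
  reflexivity.
- split; simpl; [reflexivity | exact t0 |].
  symmetry; apply inv_cancel; [now apply inv_sym | ends].
Qed.

(** * Isofibrations as lifting of invertible arrows *)

Definition iso_lifting {E : PbCategory} {A B : IntCat E} (F : IntFunctor A B) : Prop :=
  forall X (a : hom X (ic0 A)) (b b' : hom X (ic1 B)),
    is_inv b b' -> ict B ∘ b = if0 F ∘ a ->
    exists c c', is_inv c c' /\ ict A ∘ c = a /\ if1 F ∘ c = b.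

(** The internal category on [X] with identities only. Functors out of it amount to generalised
    objects [hom X (ic0 A)], which lets 2-categorical conditions be tested on single arrows. The two
    projections of [pb (idc X) (idc X)] agree, so either serves as composition. *)
Definition discrete {E : PbCategory} (X : E) : IntCat E.
Proof.
refine {| ic0 := X; ic1 := X; ics := idc X; ict := idc X; ici := idc X;
          icm := pb1 (idc X) (idc X) |}.
- abstract apply compc_idl.
- abstract apply compc_idl.
- abstract apply pb_comm.
- abstract reflexivity.
- abstract (intros; apply pb1_pair).
- abstract (intros; rewrite pb1_pair; apply compc_idl).
- abstract (intros; now rewrite !pb1_pair).
Defined.

Definition from_discrete {E : PbCategory} {X : E} {A : IntCat E} (a : hom X (ic0 A)) :
  IntFunctor (discrete X) A.
Proof.
refine (mk_functor (A := discrete X) a (ici A ∘ a) _ _ _ _); simpl.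
- abstract now rewrite compc_assoc, ics_i, compc_idl, compc_idr.
- abstract now rewrite compc_assoc, ict_i, compc_idl, compc_idr.
- abstract apply compc_idr.
- abstract (
    assert (e : pb1 (idc X) (idc X) = pb2 (idc X) (idc X))
      by (pose proof (pb_comm (idc X) (idc X)) as k; now rewrite !compc_idl in k);
    rewrite <- e, <- compc_assoc; symmetry; apply mul_idl;
    now rewrite (compc_assoc _ _ _ _ _ (ict A)), ict_i, compc_idl).
Defined.

(** Every arrow of [discrete X] is an identity, so naturality reduces to the unit laws. *)
Lemma from_discrete_nat {E : PbCategory} {X : E} {A : IntCat E}
    (F G : IntFunctor (discrete X) A) n :
  ics A ∘ n = if0 F -> ict A ∘ n = if0 G -> is_nat F G n.
Proof.
intros s t; split; [exact s | exact t |].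
pose proof (if_i F) as h; pose proof (if_i G) as h'; simpl in *.
rewrite compc_idr in h, h' |- *; rewrite h, h'.
now rewrite mul_idl, mul_idr.
Qed.

(** One direction tests the isofibration on [discrete X]. For the other, the components of [beta]
    are lifted as one arrow over [ic0 X], and conjugating [a] by the lift yields the functor
    [a']. *)
Lemma isofibrationP {E : PbCategory} {A B : IntCat E} (F : IntFunctor A B) :
  is_isofibration F <-> iso_lifting F.
Proof.
split.
- intros h X a b b' i t.
  assert (n : is_nat (from_discrete (ics B ∘ b)) (int_comp F (from_discrete a)) b)
    by now apply from_discrete_nat.
  destruct (h _ _ _ (mk_nat _ _ _ n)) as (a' & alpha & i' & _ & e).
  { apply invertible_2cellP; now exists b'. }
  apply invertible_2cellP in i' as [c' i'].
  exists (nt alpha), c'; repeat split; try apply i'; [apply (nt_t alpha) | exact e].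
- intros h X a b beta i.
  apply invertible_2cellP in i as [b' i].
  pose proof (is_nat_nt _ _ beta) as [bs bt bm].
  destruct (h _ (if0 a) _ _ i bt) as (c & c' & ic & tc & Fc).
  destruct (conj_functor a c c' ic tc) as [a' [ns nt' nm]].
  exists a', (mk_nat _ _ _ (Build_is_nat _ _ _ _ _ _ ns nt' nm)); split; [| split].
  + apply invertible_2cellP; now exists c'.
  + assert (e0 : if0 F ∘ if0 a' = if0 b) by now rewrite <- ns, <- map_s, Fc.
    apply int_functor_eq; simpl; [exact e0 |].
    (* On arrows, [F a'] and [b] satisfy the same naturality square against [beta], whose component
       at the target is invertible and can be cancelled. *)
    apply (f_equal (fun z => if1 F ∘ z)) in nm.
    pose proof (if_s a); pose proof (if_t a); pose proof (if_s a'); pose proof (if_t a').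
    pose proof (if_s b); pose proof (if_t b).
    pose proof (map_s F (if1 a')); pose proof (map_t F (if1 a')).
    assert (ics A ∘ (c ∘ ict X) = if0 a' ∘ ict X) by now rewrite compc_assoc, ns.
    assert (ict A ∘ (c ∘ ics X) = if0 a ∘ ics X) by now rewrite compc_assoc, tc.
    assert (ics B ∘ (nt beta ∘ ict X) = if0 b ∘ ict X) by now rewrite compc_assoc, bs.
    assert (if0 F ∘ (ict A ∘ if1 a') = if0 b ∘ ict X).
    { rewrite <- e0, <- compc_assoc; congruence. }
    rewrite !map_mul, !(comp_sub Fc) in nm by ends.
    pose proof (inv_pre _ _ (ict X) i) as i'.
    rewrite <- (inv_cancel _ _ (if1 F ∘ if1 a') i') by ends.
    rewrite <- nm; simpl in bm; rewrite bm.
    apply (inv_cancel _ _ _ i'); ends.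
  + exact Fc.
Qed.

(** * Equivalences as fully faithful, essentially surjective functors *)

Record rep_ff {E : PbCategory} {A B : IntCat E} (F : IntFunctor A B) : Prop := {
  rep_full : forall X (a a' : hom X (ic0 A)) (y : hom X (ic1 B)),
    ics B ∘ y = if0 F ∘ a -> ict B ∘ y = if0 F ∘ a' ->
    exists x, ics A ∘ x = a /\ ict A ∘ x = a' /\ if1 F ∘ x = y;
  rep_faithful : forall X (x x' : hom X (ic1 A)),
    ics A ∘ x = ics A ∘ x' -> ict A ∘ x = ict A ∘ x' -> if1 F ∘ x = if1 F ∘ x' ->
    x = x' }.

Definition ess_surj {E : PbCategory} {A B : IntCat E} (F : IntFunctor A B) : Prop :=
  exists (g : hom (ic0 B) (ic0 A)) b b',
    is_inv b b' /\ ics B ∘ b = idc (ic0 B) /\ ict B ∘ b = if0 F ∘ g.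

(** The inverse laws hold after applying [F], and [rep_faithful] reflects them. The ends must be
    assumed to match in [A], since [F] need not be injective on objects. *)
Lemma ff_inv {E : PbCategory} {A B : IntCat E} {F : IntFunctor A B} {X : E}
    (x x' : hom X (ic1 A)) :
  rep_ff F -> ics A ∘ x = ict A ∘ x' -> ict A ∘ x = ics A ∘ x' ->
  is_inv (if1 F ∘ x) (if1 F ∘ x') -> is_inv x x'.
Proof.
intros h s t [_ _ r l]; split; trivial; apply (rep_faithful _ h).
- rewrite mul_s, (comp_sub (ics_i A)), compc_idl; auto.
- rewrite mul_t, (comp_sub (ict_i A)), compc_idl; auto.
- rewrite map_mul, r, map_t, map_i; auto.
- rewrite mul_s, (comp_sub (ics_i A)), compc_idl; auto.
- rewrite mul_t, (comp_sub (ict_i A)), compc_idl; auto.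
- rewrite map_mul, l, map_s, map_i; auto.
Qed.

(** Fullness over [ic1 X] lifts the action of [K] on arrows in one go; faithfulness then reflects
    identities and composites. *)
Lemma ff_lift {E : PbCategory} {X A B : IntCat E} (F : IntFunctor A B)
    (K : IntFunctor X B) g :
  rep_ff F -> if0 F ∘ g = if0 K ->
  exists G : IntFunctor X A, if0 G = g /\ int_comp F G = K.
Proof.
intros h e.
destruct (rep_full _ h _ (g ∘ ics X) (g ∘ ict X) (if1 K)) as (g1 & s & t & f).
{ now rewrite if_s, <- e, compc_assoc. }
{ now rewrite if_t, <- e, compc_assoc. }
assert (gs : forall Y (z : hom Y _), ics A ∘ (g1 ∘ z) = g ∘ (ics X ∘ z))
  by (intros; now rewrite (comp_sub s), compc_assoc).
assert (gt : forall Y (z : hom Y _), ict A ∘ (g1 ∘ z) = g ∘ (ict X ∘ z))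
  by (intros; now rewrite (comp_sub t), compc_assoc).
assert (k : ics A ∘ (g1 ∘ pb1 (ics X) (ict X)) = ict A ∘ (g1 ∘ pb2 (ics X) (ict X))).
{ now rewrite gs, gt, pb_comm. }
unshelve eexists (mk_functor g g1 s t _ _).
- apply (rep_faithful _ h).
  + now rewrite gs, ics_i, (comp_sub (ics_i A)), compc_idl, compc_idr.
  + now rewrite gt, ict_i, (comp_sub (ict_i A)), compc_idl, compc_idr.
  + now rewrite compc_assoc, f, if_i, map_i, e.
- apply (rep_faithful _ h).
  + rewrite mul_s by exact k; now rewrite !gs, ics_m.
  + rewrite mul_t by exact k; now rewrite !gt, ict_m.
  + rewrite map_mul by exact k.
    rewrite !(comp_sub f), mul_icm, map_mul by apply pb_comm; reflexivity.
- split; [reflexivity |]; now apply int_functor_eq.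
Qed.

Lemma ff_lift_nat {E : PbCategory} {X A B : IntCat E} (F : IntFunctor A B)
    (G G' : IntFunctor X A) n :
  rep_ff F -> is_nat (int_comp F G) (int_comp F G') n ->
  exists m, is_nat G G' m /\ if1 F ∘ m = n.
Proof.
intros h [s t k]; simpl in *.
destruct (rep_full _ h _ _ _ _ s t) as (m & ms & mt & mf).
exists m; split; [split; trivial | exact mf].
pose proof (if_s G); pose proof (if_t G); pose proof (if_s G'); pose proof (if_t G').
assert (ict A ∘ (m ∘ ics X) = if0 G' ∘ ics X) by now rewrite compc_assoc, mt.
assert (ics A ∘ (m ∘ ict X) = if0 G ∘ ict X) by now rewrite compc_assoc, ms.
assert (ics A ∘ (m ∘ ics X) = if0 G ∘ ics X) by now rewrite compc_assoc, ms.
assert (ict A ∘ (m ∘ ict X) = if0 G' ∘ ict X) by now rewrite compc_assoc, mt.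
apply (rep_faithful _ h); [ends | ends |].
rewrite !map_mul by ends; now rewrite !(comp_sub mf).
Qed.

(** The classical argument, run on generalised arrows. Since [ess_surj] provides an actual morphism
    [g], the inverse functor is built without choosing objects. *)
Lemma equivalenceP {E : PbCategory} {A B : IntCat E} (F : IntFunctor A B) :
  is_equivalence F <-> ess_surj F /\ rep_ff F.
Proof.
split.
- intros (G & a & b & ia & ib).
  apply invertible_2cellP in ia as [a' ia], ib as [b' ib].
  pose proof (is_nat_nt _ _ a) as na; pose proof (is_nat_nt _ _ b) as nb.
  split; [exists (if0 G), (nt b), b'; split; [exact ib | split; apply nb] |].
  assert (Ffaith : forall X (x x' : hom X (ic1 A)),
    ics A ∘ x = ics A ∘ x' -> ict A ∘ x = ict A ∘ x' -> if1 F ∘ x = if1 F ∘ x' -> x = x').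
  { intros X x x' s t f.
    pose proof (nat_at na x) as k; pose proof (nat_at na x') as k'; simpl in k, k'.
    rewrite compc_idl, <- compc_assoc in k, k'; rewrite s, t, f, <- k' in k.
    pose proof (inv_pre _ _ (ics A ∘ x') ia) as i.
    assert (e : ict A ∘ (nt a ∘ (ics A ∘ x')) = ics A ∘ x')
      by (rewrite compc_assoc, nt_t; apply compc_idl).
    (* Naturality of [a] expresses [x ⋅ a] through [G (F x)] and the ends of [x]; cancelling the
       invertible component recovers [x]. *)
    apply (f_equal (fun z => z ⋅ (a' ∘ (ics A ∘ x')))) in k.
    rewrite (inv_cancel_r _ _ x i), (inv_cancel_r _ _ x' i) in k by congruence.
    exact k. }
  assert (Gfaith : forall X (x x' : hom X (ic1 B)),
    ics B ∘ x = ics B ∘ x' -> ict B ∘ x = ict B ∘ x' -> if1 G ∘ x = if1 G ∘ x' -> x = x').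
  { intros X x x' s t f.
    pose proof (nat_at nb x) as k; pose proof (nat_at nb x') as k'; simpl in k, k'.
    rewrite compc_idl, <- compc_assoc in k, k'; rewrite s, t, f, k' in k.
    pose proof (inv_pre _ _ (ict B ∘ x') ib) as i.
    assert (e : ics B ∘ (nt b ∘ (ict B ∘ x')) = ict B ∘ x')
      by (rewrite compc_assoc, nt_s; apply compc_idl).
    apply (f_equal (fun z => (b' ∘ (ict B ∘ x')) ⋅ z)) in k.
    rewrite (inv_cancel _ _ x i), (inv_cancel _ _ x' i) in k by congruence.
    now symmetry. }
  split; [| exact Ffaith].
  intros X x x' y s t.
  pose proof (inv_pre _ _ x ia) as i; pose proof (inv_pre _ _ x' ia) as i'.
  pose proof i as [is it _ _]; pose proof i' as [is' it' _ _].
  assert (as1 : ics A ∘ (nt a ∘ x) = if0 G ∘ (if0 F ∘ x))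
    by (rewrite compc_assoc, nt_s; symmetry; apply compc_assoc).
  assert (as2 : ics A ∘ (nt a ∘ x') = if0 G ∘ (if0 F ∘ x'))
    by (rewrite compc_assoc, nt_s; symmetry; apply compc_assoc).
  assert (at1 : ict A ∘ (nt a ∘ x) = x) by (rewrite compc_assoc, nt_t; apply compc_idl).
  assert (at2 : ict A ∘ (nt a ∘ x') = x') by (rewrite compc_assoc, nt_t; apply compc_idl).
  pose proof (map_s G y) as Gs; pose proof (map_t G y) as Gt.
  (* The preimage of [y] is [G y] conjugated by [a : GF => 1]. That [F z = y] is checked after
     applying the faithful [G]. *)
  pose (z := ((nt a ∘ x') ⋅ if1 G ∘ y) ⋅ (a' ∘ x)).
  assert (zs : ics A ∘ z = x) by (unfold z; ends).
  assert (zt : ict A ∘ z = x') by (unfold z; ends).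
  exists z; split; [exact zs | split; [exact zt |]].
  apply Gfaith.
  + now rewrite map_s, zs.
  + now rewrite map_t, zt.
  + pose proof (nat_at na z) as k; simpl in k.
    rewrite compc_idl, zs, zt, <- compc_assoc in k; unfold z in k at 1.
    pose proof (inv_cancel_r _ _ ((nt a ∘ x') ⋅ if1 G ∘ y) (inv_sym _ _ i)) as c.
    rewrite c in k by ends.
    pose proof (map_s F z); pose proof (map_t F z).
    pose proof (map_s G (if1 F ∘ z)); pose proof (map_t G (if1 F ∘ z)).
    rewrite <- (inv_cancel _ _ (if1 G ∘ y) i') by ends.
    rewrite k; symmetry; apply (inv_cancel _ _ _ i'); ends.
- intros ((g & b & b' & ib & bs & bt) & h).
  pose proof ib as [is it ir il].
  (* [K] is the identity functor conjugated by [b']. On objects it equals [F g], so it factors as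
     [F G] by [ff_lift]. *)
  destruct (conj_functor (int_id B) b' b) as [K nK].
  { now apply inv_sym. }
  { simpl; congruence. }
  destruct (ff_lift F K g h) as (G & <- & <-).
  { destruct nK as [ks _ _]; congruence. }
  pose proof (nat_inv _ _ _ _ nK (inv_sym _ _ ib)) as nb.
  (* The component of [b'] at [F] is a transformation [FGF => F]; full faithfulness lifts it to
     [GF => 1]. *)
  assert (n : is_nat (int_comp F (int_comp G F)) (int_comp F (int_id A)) (b' ∘ if0 F)).
  { destruct nK as [ks kt km]; split; simpl in *.
    - rewrite compc_assoc, ks; symmetry; apply compc_assoc.
    - rewrite compc_assoc, kt, compc_idl; symmetry; apply compc_idr.
    - assert (n' : is_nat (int_comp F G) (int_id B) b') by now split.
      pose proof (nat_at n' (if1 F)) as k; simpl in k.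
      rewrite compc_idl, if_s, if_t in k.
      rewrite <- !compc_assoc, compc_idr; rewrite <- compc_assoc in k; exact k. }
  destruct (ff_lift_nat F _ _ _ h n) as (m & nm & mf).
  assert (im : exists m', is_inv m m').
  { destruct (rep_full _ h _ (idc (ic0 A)) (if0 G ∘ if0 F) (b ∘ if0 F)) as (m' & ms & mt & mf').
    - now rewrite compc_assoc, bs, compc_idl, compc_idr.
    - now rewrite compc_assoc, bt, compc_assoc.
    - exists m'; destruct nm as [s t _]; simpl in s, t; apply (ff_inv _ _ h).
      + congruence.
      + congruence.
      + rewrite mf, mf'; apply inv_pre, inv_sym, ib. }
  exists G, (mk_nat _ _ _ nm), (mk_nat _ _ _ nb); split; apply invertible_2cellP.
  + exact im.
  + now exists b'.
Qed.

(** * The [tau']-epimorphisms as split graph morphisms *)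

Definition graph_split {G H : Graph} (p : GraphMor G H) : Prop :=
  exists s : GraphMor H G, graph_comp p s = graph_id H.

Lemma tau'_epiP (C B : SmallCat) (p : Functor C B) :
  tau'_epi p <-> graph_split p.
Proof.
split.
- intros h.
  (* Testing on the identity of [B] gives a cover [f] of [B] that factors through [p]; a graph
     section of [f] followed by [u] splits [p]. *)
  destruct (h B (functor_id B)) as (U & f & u & [fv fe] & e).
  apply (f_equal (@fgr _ _)) in e.
  destruct (functional_choice _ fv) as [v vP].
  (* Fullness lifts each edge between the vertices already chosen, so the choices on edges and on
     vertices form a graph morphism. *)
  assert (k : forall k : edge B, exists l, src l = v (src k) /\ tgt l = v (tgt k) /\ on_edge f l = k)
    by (intros k; apply fe; now rewrite vP).
  destruct (functional_choice _ k) as [l lP].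
  pose (s := Build_GraphMor B U v l (fun y => proj1 (lP y)) (fun y => proj1 (proj2 (lP y)))).
  exists (graph_comp u s).
  transitivity (graph_comp (graph_comp p u) s); [now apply graph_mor_ext |].
  refine (eq_trans (f_equal (fun k => graph_comp k s) e) _).
  apply graph_mor_ext; intros y; simpl; [apply vP | apply lP].
- (* The cover [U] of [X] is the full subcategory of the pullback of [p] along
     [g] on the objects chosen by the section. *)
  intros [s e] X g.
  pose proof (fun y => f_equal (fun k => on_vert k y) e) as ev.
  pose proof (fun y => f_equal (fun k => on_edge k y) e) as ee.
  simpl in ev, ee.
  pose (P := fun y : vert (cat_pb p g) =>
    fst (proj1_sig y) = on_vert s (on_vert g (snd (proj1_sig y)))).
  pose (Q := fun y : edge (cat_pb p g) => P (src y) /\ P (tgt y)).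
  assert (Qi : forall y : vert (cat_pb p g), P y -> Q (idm y)).
  { intros y h; unfold Q; rewrite src_idm, tgt_idm; now split. }
  assert (Qc : forall (k l : edge (cat_pb p g)) h, Q k -> Q l -> Q (cmp k l h)).
  { intros k l h [_ hk] [hl _]; unfold Q; rewrite src_cmp, tgt_cmp; now split. }
  pose (U := subcat (cat_pb p g) P Q (fun y => @proj1 _ _) (fun y => @proj2 _ _) Qi Qc).
  unshelve eexists U, (Build_Functor U X (Build_GraphMor U X
     (fun y => snd (proj1_sig (proj1_sig y))) (fun y => snd (proj1_sig (proj1_sig y)))
     (fun y => eq_refl) (fun y => eq_refl)) _ _),
   (Build_Functor U C (Build_GraphMor U C
     (fun y => fst (proj1_sig (proj1_sig y))) (fun y => fst (proj1_sig (proj1_sig y)))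
     (fun y => eq_refl) (fun y => eq_refl)) _ _).
  1, 3: reflexivity.
  1, 2: intros; now apply cmp_congr.
  split; [split |].
  + intros x.
    exists (exist P (exist _ (on_vert s (on_vert g x), x) (ev _)) eq_refl); reflexivity.
  + intros [[[c x] q] h] [[[c' x'] q'] h'] k hs ht; unfold P in h, h'; simpl in *; subst.
    (* Membership in [P] forces both endpoints to be the values of [s], hence [s] applied to the
       image of [k] under [g] joins exactly these endpoints. *)
    unshelve eexists (exist _ (exist _ (on_edge s (on_edge g k), k) (ee _)) _).
    { unfold Q, P; simpl; now rewrite !on_src, !on_tgt. }
    split; [| split]; [| | reflexivity]; apply sig_ext, sig_ext; simpl; now rewrite ?on_src, ?on_tgt.
  + apply functor_eq, graph_mor_ext; intros y; exact (proj2_sig (proj1_sig y)).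
Qed.

(** * Horizontally invertible arrows over graphs, and the two splitting criteria *)

Lemma mul_vert (B : DblCat) (X : Graph) (g f : GraphMor X (ic1 B)) x e :
  ics (Ubar_ob B) ∘ g = ict (Ubar_ob B) ∘ f ->
  on_vert (mul (A := Ubar_ob B) (X := X : GRAPH) g f) x = hcomp B (on_vert g x) (on_vert f x) e.
Proof.
intros h; rewrite (mulE (A := Ubar_ob B) (X := X : GRAPH) g f h).
now apply (f_equal (on_vert (icm B))), sig_ext.
Qed.

Lemma mul_edge (B : DblCat) (X : Graph) (g f : GraphMor X (ic1 B)) x e :
  ics (Ubar_ob B) ∘ g = ict (Ubar_ob B) ∘ f ->
  on_edge (mul (A := Ubar_ob B) (X := X : GRAPH) g f) x = hcomp_sq B (on_edge g x) (on_edge f x) e.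
Proof.
intros h; rewrite (mulE (A := Ubar_ob B) (X := X : GRAPH) g f h).
now apply (f_equal (on_edge (icm B))), sig_ext.
Qed.

(** The values of [h] are horizontal inverses of those of [g], so [g] factors through [iso1 B];
    [iso1_inverse] is the converse. *)
Lemma graph_inv_hinv (B : DblCat) (X : Graph) (g h : GraphMor X (ic1 B)) :
  is_inv (A := Ubar_ob B) (X := X : GRAPH) g h ->
  (forall x, hinv B (on_vert g x)) /\ (forall x, hinv_sq B (on_edge g x)).
Proof.
intros [s t r l]; split; intros x.
- assert (e : on_vert (ics B) (on_vert g x) = on_vert (ict B) (on_vert h x))
    by exact (f_equal (fun k => on_vert k x) s).
  assert (e' : on_vert (ics B) (on_vert h x) = on_vert (ict B) (on_vert g x))
    by exact (eq_sym (f_equal (fun k => on_vert k x) t)).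
  exists (on_vert h x), e, e'; split.
  + rewrite <- (mul_vert B X g h x e s); exact (f_equal (fun k => on_vert k x) r).
  + rewrite <- (mul_vert B X h g x e' (eq_sym t)); exact (f_equal (fun k => on_vert k x) l).
- assert (e : on_edge (ics B) (on_edge g x) = on_edge (ict B) (on_edge h x))
    by exact (f_equal (fun k => on_edge k x) s).
  assert (e' : on_edge (ics B) (on_edge h x) = on_edge (ict B) (on_edge g x))
    by exact (eq_sym (f_equal (fun k => on_edge k x) t)).
  exists (on_edge h x), e, e'; split.
  + rewrite <- (mul_edge B X g h x e s); exact (f_equal (fun k => on_edge k x) r).
  + rewrite <- (mul_edge B X h g x e' (eq_sym t)); exact (f_equal (fun k => on_edge k x) l).
Qed.

Definition to_iso1 (B : DblCat) (X : Graph) (g : GraphMor X (ic1 B))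
    (hv : forall x, hinv B (on_vert g x)) (he : forall x, hinv_sq B (on_edge g x)) :
  GraphMor X (iso1 B).
Proof.
refine (Build_GraphMor X (iso1 B) (fun x => exist _ (on_vert g x) (hv x))
  (fun x => exist _ (on_edge g x) (he x)) _ _).
- abstract (intros x; apply sig_ext; simpl; apply on_src).
- abstract (intros x; apply sig_ext; simpl; apply on_tgt).
Defined.

(** Inverses are chosen separately on vertices and on edges; uniqueness of horizontal inverses
    forces the choices to respect sources and targets. *)
Lemma iso1_inverse (B : DblCat) (X : Graph) (g : GraphMor X (iso1 B)) :
  exists h, is_inv (A := Ubar_ob B) (X := X : GRAPH) (graph_comp (iso1_incl B) g) h.
Proof.
destruct (functional_choice _ (fun x => proj2_sig (on_vert g x))) as [v vP].
destruct (functional_choice _ (fun x => proj2_sig (on_edge g x))) as [w wP].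
assert (ws : forall x, src (w x) = v (src x)).
{ intros x; destruct (wP x) as (e & e' & r & l), (vP (src x)) as (f & f' & r' & l').
  revert f f' r' l'; rewrite <- on_src; simpl; intros f f' r' l'.
  assert (k1 : on_vert (ics B) (src (proj1_sig (on_edge g x))) = on_vert (ict B) (src (w x)))
    by now rewrite <- !on_src, e.
  assert (k2 : on_vert (ics B) (src (w x)) = on_vert (ict B) (src (proj1_sig (on_edge g x))))
    by now rewrite <- !on_src, e'.
  apply (hinv_unique B _ _ _ k1 k2 f f'); trivial.
  + now rewrite <- hcomp_sq_src with (e := e), r, !on_src.
  + now rewrite <- hcomp_sq_src with (e := e'), l, !on_src. }
assert (wt : forall x, tgt (w x) = v (tgt x)).
{ intros x; destruct (wP x) as (e & e' & r & l), (vP (tgt x)) as (f & f' & r' & l').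
  revert f f' r' l'; rewrite <- on_tgt; simpl; intros f f' r' l'.
  assert (k1 : on_vert (ics B) (tgt (proj1_sig (on_edge g x))) = on_vert (ict B) (tgt (w x)))
    by now rewrite <- !on_tgt, e.
  assert (k2 : on_vert (ics B) (tgt (w x)) = on_vert (ict B) (tgt (proj1_sig (on_edge g x))))
    by now rewrite <- !on_tgt, e'.
  apply (hinv_unique B _ _ _ k1 k2 f f'); trivial.
  + now rewrite <- hcomp_sq_tgt with (e := e), r, !on_tgt.
  + now rewrite <- hcomp_sq_tgt with (e := e'), l, !on_tgt. }
pose (h := Build_GraphMor X (ic1 B) v w ws wt); exists h.
  assert (s : ics (Ubar_ob B) ∘ graph_comp (iso1_incl B) g = ict (Ubar_ob B) ∘ h).
  { apply graph_mor_ext; intros x; [now destruct (vP x) | now destruct (wP x)]. }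
  assert (t : ics (Ubar_ob B) ∘ h = ict (Ubar_ob B) ∘ graph_comp (iso1_incl B) g).
  { apply graph_mor_ext; intros x; [now destruct (vP x) as (? & ? & _) | now destruct (wP x) as (? & ? & _)]. }
  split; [exact s | now symmetry | |]; apply graph_mor_ext; intros x.
  + destruct (vP x) as (e & e' & r & l); rewrite (mul_vert B X (graph_comp (iso1_incl B) g) h x e s); exact r.
  + destruct (wP x) as (e & e' & r & l); rewrite (mul_edge B X (graph_comp (iso1_incl B) g) h x e s); exact r.
  + destruct (vP x) as (e & e' & r & l); rewrite (mul_vert B X h (graph_comp (iso1_incl B) g) x e' t); exact l.
  + destruct (wP x) as (e & e' & r & l); rewrite (mul_edge B X h (graph_comp (iso1_incl B) g) x e' t); exact l.
Qed.

(** As a graph, [PF0 F] classifies pairs of an object of [A] and an invertible arrow of [B] into its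
    image. A section of [rF0 F] lifts the universal such pair, and every other lift is obtained by
    precomposition. *)
Lemma graph_split_rF0 (A B : DblCat) (F : hom A B) :
  graph_split (rF0 F) <-> iso_lifting (Ubar F).
Proof.
split.
- intros [s e] X a b b' i t.
  destruct (graph_inv_hinv B X b b' i) as [hv he].
  assert (k : graph_comp (if0 F) a = graph_comp (iso1_t B) (to_iso1 B X b hv he)).
  { apply graph_mor_ext; intros x; symmetry.
    - exact (f_equal (fun k => on_vert k x) t).
    - exact (f_equal (fun k => on_edge k x) t). }
  pose (u := graph_pair (f := if0 F) (g := iso1_t B) a (to_iso1 B X b hv he) k).
  destruct (iso1_inverse A X (graph_comp s u)) as [c' ic].
  exists (graph_comp (iso1_incl A) (graph_comp s u)), c'; split; [exact ic |].
  split; apply graph_mor_ext; intros x.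
  + exact (f_equal (fun k : GraphMor (PF0 F) (PF0 F) => fst (proj1_sig (on_vert k (on_vert u x)))) e).
  + exact (f_equal (fun k : GraphMor (PF0 F) (PF0 F) => fst (proj1_sig (on_edge k (on_edge u x)))) e).
  + exact (f_equal (fun k : GraphMor (PF0 F) (PF0 F) => proj1_sig (snd (proj1_sig (on_vert k (on_vert u x))))) e).
  + exact (f_equal (fun k : GraphMor (PF0 F) (PF0 F) => proj1_sig (snd (proj1_sig (on_edge k (on_edge u x))))) e).
- intros h.
  (* The lifting property is applied to the universal pair, given by the two projections of
     [PF0 F]. *)
  destruct (iso1_inverse B (PF0 F) (PF0_proj F)) as [b' i].
  destruct (h (gr (PF0 F)) (graph_pb1 (if0 F) (iso1_t B)) _ _ i) as (c & c' & ic & tc & Fc).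
  { apply graph_mor_ext; intros x; symmetry; exact (proj2_sig x). }
  destruct (graph_inv_hinv A (PF0 F) c c' ic) as [hv he].
  exists (to_iso1 A _ c hv he); apply graph_mor_ext; intros z.
  + apply (@sig_ext _ (fun z => on_vert (if0 F) (fst z) = on_vert (iso1_t B) (snd z))).
    refine (eq_trans (f_equal2 pair _ (sig_ext _ _ _)) (eq_sym (surjective_pairing _))).
    * exact (f_equal (fun k => on_vert k z) tc).
    * exact (f_equal (fun k => on_vert k z) Fc).
  + apply (@sig_ext _ (fun z => on_edge (if0 F) (fst z) = on_edge (iso1_t B) (snd z))).
    refine (eq_trans (f_equal2 pair _ (sig_ext _ _ _)) (eq_sym (surjective_pairing _))).
    * exact (f_equal (fun k => on_edge k z) tc).
    * exact (f_equal (fun k => on_edge k z) Fc).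
Qed.

(** A graph morphism from [ic0 B] to [PF0 F] amounts to a morphism [g] and an invertible arrow [b]
    with target [F g]; it is a section exactly when the source of [b] is the identity. *)
Lemma graph_split_PF0 (A B : DblCat) (F : hom A B) :
  graph_split (functor_comp (iso1_s B) (PF0_proj F)) <-> ess_surj (Ubar F).
Proof.
split.
- intros [s e].
  destruct (iso1_inverse B (ic0 B) (graph_comp (PF0_proj F) s)) as [b' i].
  exists (graph_comp (graph_pb1 (if0 F) (iso1_t B)) s),
    (graph_comp (iso1_incl B) (graph_comp (PF0_proj F) s)), b'.
  split; [exact i | split].
  + apply graph_mor_ext; intros x.
    * exact (f_equal (fun k => on_vert k x) e).
    * exact (f_equal (fun k => on_edge k x) e).
  + apply graph_mor_ext; intros x; symmetry.
    * exact (proj2_sig (on_vert s x)).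
    * exact (proj2_sig (on_edge s x)).
- intros (g & b & b' & i & s & t).
  destruct (graph_inv_hinv B (ic0 B) b b' i) as [hv he].
  assert (k : graph_comp (if0 F) g = graph_comp (iso1_t B) (to_iso1 B (ic0 B) b hv he)).
  { apply graph_mor_ext; intros x; symmetry.
    - exact (f_equal (fun k => on_vert k x) t).
    - exact (f_equal (fun k => on_edge k x) t). }
  exists (graph_pair (f := if0 F) (g := iso1_t B) g (to_iso1 B (ic0 B) b hv he) k).
  apply graph_mor_ext; intros x.
  + exact (f_equal (fun k => on_vert k x) s).
  + exact (f_equal (fun k => on_edge k x) s).
Qed.

(** * Full faithfulness in categories and in graphs *)

Definition arrow_graph : Graph := {|
  vert := bool; edge := unit; src := fun _ => true; tgt := fun _ => false |}.

Definition edge_mor {G : Graph} (k : edge G) : GraphMor arrow_graph G := {|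
  on_vert := fun b : vert arrow_graph => if b then src k else tgt k;
  on_edge := fun _ : edge arrow_graph => k;
  on_src := fun _ => eq_refl;
  on_tgt := fun _ => eq_refl |}.

Lemma comp_edge_mor {G H : Graph} (f : GraphMor G H) (k : edge G) :
  graph_comp f (edge_mor k) = edge_mor (on_edge f k).
Proof.
apply graph_mor_ext; intros x; simpl; [| reflexivity].
destruct x; symmetry; [apply on_src | apply on_tgt].
Qed.

(** Graph morphisms out of the walking edge [arrow_graph] are edges, so [rep_faithful] is evaluated
    at that stage. *)
Lemma rep_faithful_edge (A B : DblCat) (F : hom A B) (k k' : edge (ic1 A)) :
  rep_ff (Ubar F) ->
  on_edge (ics A) k = on_edge (ics A) k' -> on_edge (ict A) k = on_edge (ict A) k' ->
  on_edge (if1 F) k = on_edge (if1 F) k' -> k = k'.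
Proof.
intros h s t f.
exact (f_equal (fun m : GraphMor arrow_graph (ic1 A) => on_edge m tt)
  (rep_faithful _ h arrow_graph (edge_mor k) (edge_mor k')
     (eq_trans (comp_edge_mor (ics A) k) (eq_trans (f_equal _ s) (eq_sym (comp_edge_mor (ics A) k'))))
     (eq_trans (comp_edge_mor (ict A) k) (eq_trans (f_equal _ t) (eq_sym (comp_edge_mor (ict A) k'))))
     (eq_trans (comp_edge_mor (if1 F) k) (eq_trans (f_equal _ f) (eq_sym (comp_edge_mor (if1 F) k')))))).
Qed.

Lemma fully_faithful_rep (A B : DblCat) (F : hom A B) :
  fully_faithful F <-> rep_ff (Ubar F).
Proof.
split.
- intros [c h].
  pose (P := cat_prod_map (if0 F) (if0 F)); pose (Q := cat_prod_pair (ics B) (ict B)).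
  (* Comparison functor [w] from the concrete pullback to [ic1 A]. Any graph maps into the concrete
     pullback componentwise, so composing with [w] yields fullness at all graphs, not only at
     categories. *)
  destruct (h (cat_pb P Q) (cat_pb1 P Q) (cat_pb2 P Q) (pb_comm (p := CAT) P Q)) as (w & [w1 w2] & _).
  split.
  + intros X a a' y s t.
    pose proof (fun x => f_equal (fun k => on_vert k x) s) as sv.
    pose proof (fun x => f_equal (fun k => on_edge k x) s) as se.
    pose proof (fun x => f_equal (fun k => on_vert k x) t) as tv.
    pose proof (fun x => f_equal (fun k => on_edge k x) t) as te.
    unshelve epose (u := Build_GraphMor X (cat_pb P Q)
      (fun x => exist _ ((on_vert a x, on_vert a' x), on_vert y x) _)
      (fun x => exist _ ((on_edge a x, on_edge a' x), on_edge y x) _) _ _).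
    * simpl in *; now rewrite sv, tv.
    * simpl in *; now rewrite se, te.
    * intros x; apply sig_ext; simpl; now rewrite !on_src.
    * intros x; apply sig_ext; simpl; now rewrite !on_tgt.
    * exists (graph_comp w u).
      split; [| split]; apply graph_mor_ext; intros x.
      -- exact (f_equal (fun k : Functor _ (cat_prod _ _) => fst (on_vert k (on_vert u x))) w1).
      -- exact (f_equal (fun k : Functor _ (cat_prod _ _) => fst (on_edge k (on_edge u x))) w1).
      -- exact (f_equal (fun k : Functor _ (cat_prod _ _) => snd (on_vert k (on_vert u x))) w1).
      -- exact (f_equal (fun k : Functor _ (cat_prod _ _) => snd (on_edge k (on_edge u x))) w1).
      -- exact (f_equal (fun k : Functor _ _ => on_vert k (on_vert u x)) w2).
      -- exact (f_equal (fun k : Functor _ _ => on_edge k (on_edge u x)) w2).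
  + intros X x x' s t f.
    pose (r := cat_pair (cat_prod_pair (ics A) (ict A)) (if1 F) c : Functor (ic1 A) (cat_pb P Q)).
    (* Uniqueness in the pullback property makes [w] a retraction of [r], so an arrow of [A] is
       determined by its source, its target and its image under [F]. *)
    assert (e : functor_comp w r = functor_id (ic1 A)).
    { destruct (h (ic1 A) (cat_prod_pair (ics A) (ict A)) (if1 F) c) as (z & _ & zu).
      rewrite <- (zu (functor_comp w r)), <- (zu (functor_id (ic1 A))); [reflexivity | |].
      - split; apply compc_idr.
      - split; apply functor_eq, graph_mor_ext; intros k.
        + exact (f_equal (fun l : Functor _ (cat_prod _ _) => on_vert l (on_vert r k)) w1).
        + exact (f_equal (fun l : Functor _ (cat_prod _ _) => on_edge l (on_edge r k)) w1).
        + exact (f_equal (fun l : Functor _ _ => on_vert l (on_vert r k)) w2).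
        + exact (f_equal (fun l : Functor _ _ => on_edge l (on_edge r k)) w2). }
    apply graph_mor_ext; intros k.
    * transitivity (on_vert (functor_comp w r) (on_vert x k)); [now rewrite e |].
      transitivity (on_vert (functor_comp w r) (on_vert x' k)); [| now rewrite e].
      apply (f_equal (on_vert w)), sig_ext; simpl.
      refine (f_equal2 pair (f_equal2 pair _ _) _); [exact (f_equal (fun l => on_vert l k) s)
        | exact (f_equal (fun l => on_vert l k) t) | exact (f_equal (fun l => on_vert l k) f)].
    * transitivity (on_edge (functor_comp w r) (on_edge x k)); [now rewrite e |].
      transitivity (on_edge (functor_comp w r) (on_edge x' k)); [| now rewrite e].
      apply (f_equal (on_edge w)), sig_ext; simpl.
      refine (f_equal2 pair (f_equal2 pair _ _) _); [exact (f_equal (fun l => on_edge l k) s)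
        | exact (f_equal (fun l => on_edge l k) t) | exact (f_equal (fun l => on_edge l k) f)].
- intros h; split.
  { pose proof (if_s F) as s; pose proof (if_t F) as t.
    apply functor_eq, graph_mor_ext; intros x; symmetry; refine (f_equal2 pair _ _).
    - exact (f_equal (fun k : Functor _ _ => on_vert k x) s).
    - exact (f_equal (fun k : Functor _ _ => on_vert k x) t).
    - exact (f_equal (fun k : Functor _ _ => on_edge k x) s).
    - exact (f_equal (fun k : Functor _ _ => on_edge k x) t). }
  intros X U V e.
  pose proof (fun k k' => rep_faithful_edge A B F k k' h) as inj.
  pose (a := Build_GraphMor X (ic0 A) (fun x => fst (on_vert U x)) (fun x => fst (on_edge U x))
     (fun x => f_equal fst (on_src U x)) (fun x => f_equal fst (on_tgt U x))).
  pose (a' := Build_GraphMor X (ic0 A) (fun x => snd (on_vert U x)) (fun x => snd (on_edge U x))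
     (fun x => f_equal snd (on_src U x)) (fun x => f_equal snd (on_tgt U x))).
  (* Fullness at the underlying graph of [X] gives only a graph morphism [w]; its functoriality then
     follows from faithfulness on edges, because [U] and [V] are functors. *)
  destruct (rep_full _ h (gr X) a a' (fgr V)) as (w & ws & wt & wf).
  { apply graph_mor_ext; intros x; symmetry.
    - exact (f_equal (fun k : Functor _ (cat_prod _ _) => fst (on_vert k x)) e).
    - exact (f_equal (fun k : Functor _ (cat_prod _ _) => fst (on_edge k x)) e). }
  { apply graph_mor_ext; intros x; symmetry.
    - exact (f_equal (fun k : Functor _ (cat_prod _ _) => snd (on_vert k x)) e).
    - exact (f_equal (fun k : Functor _ (cat_prod _ _) => snd (on_edge k x)) e). }
  pose proof (fun x => f_equal (fun k => on_vert k x) ws) as sv.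
  pose proof (fun x => f_equal (fun k => on_edge k x) ws) as se.
  pose proof (fun x => f_equal (fun k => on_vert k x) wt) as tv.
  pose proof (fun x => f_equal (fun k => on_edge k x) wt) as te.
  pose proof (fun x => f_equal (fun k => on_vert k x) wf) as fv.
  pose proof (fun x => f_equal (fun k => on_edge k x) wf) as fe.
  simpl in sv, se, tv, te, fv, fe.
  assert (wi : forall x, on_edge w (idm x) = idm (on_vert w x)).
  { intros x; apply inj.
    - rewrite se, f_idm, f_idm, sv; reflexivity.
    - rewrite te, f_idm, f_idm, tv; reflexivity.
    - rewrite fe, f_idm, f_idm, fv; reflexivity. }
  assert (wc : forall g f k k', on_edge w (cmp g f k) = cmp (on_edge w g) (on_edge w f) k').
  { intros g f k k'; apply inj.
    - rewrite se; unshelve erewrite !f_cmp; [now rewrite on_src, on_tgt, k | now rewrite !on_src, !on_tgt, k |].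
      simpl; now apply cmp_congr.
    - rewrite te; unshelve erewrite !f_cmp; [now rewrite on_src, on_tgt, k | now rewrite !on_src, !on_tgt, k |].
      simpl; now apply cmp_congr.
    - rewrite fe; unshelve erewrite !f_cmp; [now rewrite on_src, on_tgt, k | now rewrite !on_src, !on_tgt, k |].
      now apply cmp_congr. }
  exists (Build_Functor X (ic1 A) w wi wc); split; [split |].
  + apply functor_eq, graph_mor_ext; intros x.
    * transitivity (fst (on_vert U x), snd (on_vert U x)); [| symmetry; apply surjective_pairing].
      refine (f_equal2 pair _ _); [apply sv | apply tv].
    * transitivity (fst (on_edge U x), snd (on_edge U x)); [| symmetry; apply surjective_pairing].
      refine (f_equal2 pair _ _); [apply se | apply te].
  + apply functor_eq; exact wf.
  + intros w' [p q]; apply functor_eq.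
    refine (rep_faithful _ h (gr X) w (fgr w') (eq_trans ws _) (eq_trans wt _) (eq_trans wf _)).
    * apply graph_mor_ext; intros x.
      -- exact (f_equal (fun k : Functor _ (cat_prod _ _) => fst (on_vert k x)) (eq_sym p)).
      -- exact (f_equal (fun k : Functor _ (cat_prod _ _) => fst (on_edge k x)) (eq_sym p)).
    * apply graph_mor_ext; intros x.
      -- exact (f_equal (fun k : Functor _ (cat_prod _ _) => snd (on_vert k x)) (eq_sym p)).
      -- exact (f_equal (fun k : Functor _ (cat_prod _ _) => snd (on_edge k x)) (eq_sym p)).
    * exact (f_equal (@fgr _ _) (eq_sym q)).
Qed.

Theorem theorem9p1 : Mbar_model_structure = tau'_model_structure.
Proof.
assert (w : Mbar_weq = tau'_weq).
{ extensionality A; extensionality B; extensionality F.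
  apply propositional_extensionality; unfold Mbar_weq, tau'_weq.
  now rewrite tau'_epiP, graph_split_PF0, fully_faithful_rep, equivalenceP. }
assert (f : Mbar_fib = tau'_fib).
{ extensionality A; extensionality B; extensionality F.
  apply propositional_extensionality; unfold Mbar_fib, tau'_fib.
  now rewrite tau'_epiP, graph_split_rF0, isofibrationP. }
(* On both sides the cofibrations are defined by lifting against the other two classes, so they
   agree once those do. *)
unfold Mbar_model_structure, tau'_model_structure; now rewrite w, f.
Qed.
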